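(* Let $\mu\in\mathbb R$, let $\psi:\mathbb Z^2\to\mathbb C$ be a discrete holomorphic function with edge-labelling $(m_{ij})$, and let $m\in\mathbb R\setminus\{0\}$ with $m_{ij}+m\neq 0$ on all edges. Let $\Psi:\mathbb Z^2\to SL(2,\mathbb C)$ be a solution of $$\Psi_j=\Psi_iB_{ij},\qquad B_{ij}=\frac{1}{(\psi_i-\psi_j)\sqrt{m_{ij}}\sqrt{m_{ij}+m}}\begin{pmatrix} m_{ij}(\psi_i-\psi_j)+m\psi_i & -m\psi_i\psi_j\\ m & m_{ij}(\psi_i-\psi_j)-m\psi_j\end{pmatrix}$$ on all edges, and assume $\mu|\psi|^2\neq1$ at all vertices. Then the two discrete surfaces $x^{\pm}$ whose Hermitian representatives are $$X^\pm=\Psi\, C^\pm\,\Psi^\ast,\qquad C^\pm=\frac{1}{1-\mu|\psi|^2}\begin{pmatrix}1\pm|\psi|^2&(\mu\pm1)\psi\\(\mu\pm1)\overline\psi&\pm1+\mu^2|\psi|^2\end{pmatrix}$$ are a pair of discrete BrLW/BiLW surfaces in hyperbolic/de Sitter space (with parameter $\mu$, and with respect to the Gauss maps induced by $G=\Big\langle\Psi\begin{pmatrix}|\psi|^2&\psi\\ \overline\psi&1\end{pmatrix}\Psi^\ast\Big\rangle$): $x^+$ is a discrete BrLW surface in hyperbolic space and $x^-$ is a discrete BiLW surface in de Sitter space. Every pair of discrete BrLW/BiLW surfaces can be constructed in this way.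
   Context: **Minkowski space.** $\mathbb R^{3,1}$ is the real vector space with basis $e_0,e_1,e_2,e_3$ and product $(e_0,e_0)=-1$, $(e_n,e_n)=1$ ($n=1,2,3$), $(e_n,e_{n'})=0$ for $n\ne n'$. $\mathcal L=\{v:(v,v)=0\}$; $\mathbb P\mathcal L$ is the set of one-dimensional null subspaces; $\langle\cdot\rangle$ denotes linear span. In the Hermitian model $\mathbb R^{3,1}$ is the space of Hermitian $2\times2$ matrices with $(v,v)=-\det v$, where $e_0=\begin{pmatrix}1&0\\0&1\end{pmatrix}$, $e_1=\begin{pmatrix}0&1\\1&0\end{pmatrix}$, $e_2=\begin{pmatrix}0&\mathrm i\\-\mathrm i&0\end{pmatrix}$, $e_3=\begin{pmatrix}1&0\\0&-1\end{pmatrix}$; $B\in SL(2,\mathbb C)$ acts by $v\mapsto BvB^\ast$, $B^\ast=\overline B^T$. ''Hyperbolic space'' means the quadric $\{(x,x)=-1\}$ (two copies of $\mathbb H^3$); ''de Sitter space'' means $\{(x,x)=1\}$. **Discrete holomorphic.** $(ijkl)$ denotes an elementary quadrilateral (face) of $\mathbb Z^2$ with vertices in cyclic order. $\psi:\mathbb Z^2\to\mathbb C$ is discrete holomorphic if there is a real nowhere zero edge function $m_{ij}=m_{ji}$, equal on opposite edges of each face ($m_{ij}=m_{lk}$, $m_{il}=m_{jk}$), with $\frac{\psi_i-\psi_j}{\psi_j-\psi_k}\frac{\psi_k-\psi_l}{\psi_l-\psi_i}=\frac{m_{il}}{m_{ij}}<0$ on each face. The matrices $B_{ij}$ are determined up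 to sign; the (possibly imaginary) square roots are chosen independently of the direction of an edge and equal on opposite edges of a face. **Discrete surfaces.** A discrete surface is a map $x:\mathbb Z^2\to\mathbb R^{3,1}$; $\delta x_{ik}=x_i-x_k$. It is planar if each face is mapped to coplanar points, and circular if it is planar and for each face there is $c\in\mathbb R^{3,1}$ with $(x-c,x-c)$ equal at its four vertices. Two discrete surfaces $x,y$ are edge-parallel if corresponding edge vectors $x_i-x_j$, $y_i-y_j$ are parallel; for these the mixed area is $A(x,y)_{ijkl}=\frac14(\delta x_{ik}\wedge\delta y_{jl}-\delta x_{jl}\wedge\delta y_{ik})\in\Lambda^2\mathbb R^{3,1}$. Standing assumption: discrete surfaces for which curvatures are considered satisfy $A(x,x)\neq0$ on every face. A discrete Legendre immersion is a map $L$ from $\mathbb Z^2$ to the affine null lines of $\mathbb R^{3,1}$ with $L_i\cap L_j\ne\emptyset$ for every edge; it has the form $L=x+G$ with $x_i\in L_i$ and lightlike Gauss map $G:\mathbb Z^2\to\mathbb P\mathcal L$. **BrLW/BiLW.** Let $x^{+}$ (resp. $x^-$) be a circular discrete surface with $(x^\pm,x^\pm)=\mp1$, and $G:\mathbb Z^2\to\mathbb P\mathcal L$ such that $x^\pm+G$ is a discrete Legendre immersion and $x^\pm_i\not\perp G_i$. For any lift $g$ of $G$ ($\langle g_i\rangle = G_i$) put $n^\pm=\mp\frac{g}{(g,x^\pm)}-x^\pm$ (the Gauss map induced by $G$; it is orthogonal to and edge-parallel to $x^\pm$). The discrete mean curvature $H$ and extrinsic Gauss curvature $K$ are defined on faces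 by $A(x^\pm,n^\pm)+HA(x^\pm,x^\pm)=0$ and $A(n^\pm,n^\pm)-KA(x^\pm,x^\pm)=0$. $x^+$ is BrLW (linear Weingarten of Bryant type), resp. $x^-$ is BiLW (of Bianchi type), with parameter $\mu\in\mathbb R$ if $(\mu\pm1)K-2\mu H+(\mu\mp1)=0$ on all faces. A pair of BrLW/BiLW surfaces consists of a BrLW surface $x^+$ and a BiLW surface $x^-$ with the same $G$, the same parameter $\mu$ and $x^\pm+G=L$ one and the same Legendre immersion, related by $x^-=-n^+$. The standing assumption also applies to the section $x^M=x^\pm+\frac{\mu\pm1}{2(g,x^\pm)}g$ of $L$. Also assumed: on each face the four lines $G_i,G_j,G_k,G_l$ span a space of dimension at least $3$.
   Formalization: Sign cases corrected: X^± carries vertex signs e_i=±1 with e_i e_j m_ij(m_ij+m)>0 (e=1 allowed if all m_ij(m_ij+m)>0); the converse, up to these signs, holds exactly for pairs whose induced edge labels have opposite signs on adjacent edges of each face. *)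

(* Defs.v *)
From HB Require Import structures.
From mathcomp Require Import all_boot all_order all_algebra.
From mathcomp Require Import complex classical_sets reals.

Set Implicit Arguments.
Unset Strict Implicit.
Unset Printing Implicit Defensive.

Import Order.TTheory GRing.Theory Num.Theory.
Local Open Scope ring_scope.
Local Open Scope complex_scope.

(* The square lattice Z^2. *)
Definition Z2 : Type := (int * int)%type.

Definition edge (i j : Z2) : bool := `|i.1 - j.1| + `|i.2 - j.2| == 1.

(* A closed 4-path in Z^2 without backtracking is an elementary quadrilateral;
   each quadrilateral occurs here with all its eight cyclic labellings. *)
Definition face (i j k l : Z2) : bool :=
  [&& edge i j, edge j k, edge k l, edge l i, i != k & j != l].

(* The space R^{3,1}, with coordinates v 0 0, ..., v 0 3 in the basis
   e_0, ..., e_3. *)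
Notation mink R := 'rV[R]_4.

Definition mprod (R : realType) (u v : mink R) : R :=
  - (u 0 0 * v 0 0) + \sum_(n < 4 | n != 0) u 0 n * v 0 n.

Definition mx2 (C : Type) (a b c d : C) : 'M[C]_2 :=
  \matrix_(p < 2, q < 2)
    if p == 0 then (if q == 0 then a else b) else (if q == 0 then c else d).

(* v 0 0 e_0 + ... + v 0 3 e_3, with e_0 = 1, e_1 = (0 1 | 1 0),
   e_2 = (0 i | -i 0), e_3 = diag(1, -1); thus (v, v) = - det (herm v). *)
Definition herm (R : realType) (v : mink R) : 'M[R[i]]_2 :=
  mx2 (v 0 0 + v 0 3%:R)%:C          (v 0 1 +i* v 0 2%:R)
      (v 0 1 -i* v 0 2%:R)           (v 0 0 - v 0 3%:R)%:C.

Definition adjoint (R : realType) (A : 'M[R[i]]_2) : 'M[R[i]]_2 :=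
  map_mx Num.conj A^T.

(* The bivector u /\ v as a skew-symmetric matrix. *)
Definition wedge (R : realType) (u v : mink R) : 'M[R]_4 :=
  u^T *m v - v^T *m u.

Section Surfaces.

Variable R : realType.
Implicit Types (x y n g : Z2 -> mink R) (G : Z2 -> {vspace mink R}).
Implicit Types (mu s : R).

Definition null_line (U : {vspace mink R}) : Prop :=
  \dim U = 1%N /\ forall v, v \in U -> mprod v v = 0.

Definition is_lift g G : Prop := forall i, G i = <[g i]>%VS.

Definition planar x : Prop := forall i j k l, face i j k l ->
  (\dim <<[:: (x j - x i)%R; (x k - x i)%R; (x l - x i)%R]>>%VS <= 2)%N.

Definition circular x : Prop :=
  planar x /\
  forall i j k l, face i j k l -> exists c : mink R,
    [/\ mprod (x j - c) (x j - c) = mprod (x i - c) (x i - c),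
        mprod (x k - c) (x k - c) = mprod (x i - c) (x i - c) &
        mprod (x l - c) (x l - c) = mprod (x i - c) (x i - c)].

Definition mixed_area x y (i j k l : Z2) : 'M[R]_4 :=
  4%:R^-1 *: (wedge (x i - x k) (y j - y l) - wedge (x j - x l) (y i - y k)).

Definition regular x : Prop := forall i j k l, face i j k l ->
  mixed_area x x i j k l != 0.

Definition affine_line (p : mink R) (U : {vspace mink R}) : set (mink R) :=
  [set q | q - p \in U]%classic.

Definition legendre_immersion (L : Z2 -> set (mink R)) : Prop :=
  (forall i, exists p U, null_line U /\ L i = affine_line p U) /\
  (forall i j, edge i j -> (L i `&` L j !=set0)%classic).

(* In the sequel s = 1 for the surface x^+ in hyperbolic space and s = -1 for
   the surface x^- in de Sitter space. *)

Definition gauss_map s x g (i : Z2) : mink R :=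
  - (s / mprod (g i) (x i)) *: g i - x i.

(* The section x^M of the Legendre immersion. *)
Definition middle_section mu s x g (i : Z2) : mink R :=
  x i + ((mu + s) / (2%:R * mprod (g i) (x i))) *: g i.

(* The discrete mean and extrinsic Gauss curvatures H and K on the face
   (ijkl); for regular x there is at most one such H and one such K. *)
Definition face_curvatures x n (i j k l : Z2) (H K : R) : Prop :=
  mixed_area x n i j k l + H *: mixed_area x x i j k l = 0 /\
  mixed_area n n i j k l - K *: mixed_area x x i j k l = 0.

(* BrLW for s = 1 and BiLW for s = -1, with respect to the Gauss map induced
   by G. *)
Definition linear_weingarten mu s x G : Prop :=
  [/\ circular x,
      forall i, mprod (x i) (x i) = - s,
      (forall i, null_line (G i)) /\
        legendre_immersion (fun i => affine_line (x i) (G i)),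
      (forall i, exists2 v, v \in G i & mprod v (x i) != 0) /\ regular x &
      forall g, is_lift g G ->
        regular (middle_section mu s x g) /\
        forall i j k l, face i j k l -> exists H K,
          face_curvatures x (gauss_map s x g) i j k l H K /\
          (mu + s) * K - 2%:R * mu * H + (mu - s) = 0].

Definition BrLW_BiLW_pair mu (xp xm : Z2 -> mink R) G : Prop :=
  [/\ linear_weingarten mu 1 xp G,
      linear_weingarten mu (-1) xm G,
      forall i j k l, face i j k l -> (3 <= \dim (G i + G j + G k + G l)%VS)%N,
      forall i, affine_line (xp i) (G i) = affine_line (xm i) (G i) &
      forall g, is_lift g G -> forall i, xm i = - gauss_map 1 xp g i].

(* On an edge (ij) put t_ij = (x^M_j, g_i) / (x^M_i, g_i).  If the pair is
   obtained from psi and (m_ij) with parameter m, then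
   t_ij = m_ij / (m_ij + m), so m_ij = m t_ij / (1 - t_ij) is determined by
   the pair up to the scale m.  The condition says that these numbers have
   opposite signs on adjacent edges of each face, which is the requirement
   m_il / m_ij < 0 in the definition of discrete holomorphic functions. *)
Definition opposite_labels mu (xp : Z2 -> mink R) G : Prop :=
  forall g, is_lift g G ->
  let xM := middle_section mu 1 xp g in
  let t i j := mprod (g i) (xM j) / mprod (g i) (xM i) in
  forall i j k l, face i j k l ->
    (t i j * (1 - t i j)) * (t i l * (1 - t i l)) < 0.

End Surfaces.

Section Weierstrass.

Variable R : realType.
Notation C := R[i].
Implicit Types (psi : Z2 -> C) (ml : Z2 -> Z2 -> R) (r : Z2 -> Z2 -> C).

(* Division by zero yields 0, so the cross-ratio condition forces
   psi i != psi j on every edge. *)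
Definition discrete_holomorphic psi ml : Prop :=
  (forall i j, edge i j -> ml i j = ml j i /\ ml i j != 0) /\
  (forall i j k l, face i j k l ->
    [/\ ml i j = ml l k, ml i l = ml j k,
        (psi i - psi j) / (psi j - psi k) * ((psi k - psi l) / (psi l - psi i))
          = (ml i l / ml i j)%:C &
        ml i l / ml i j < 0]).

(* r is a choice of (possibly imaginary) square roots of the edge function
   ml. *)
Definition edge_sqrt ml r : Prop :=
  (forall i j, edge i j -> r i j = r j i /\ r i j ^+ 2 = (ml i j)%:C) /\
  (forall i j k l, face i j k l -> r i j = r l k /\ r i l = r j k).

(* The matrix B_ij for p = psi i, q = psi j, with a = m_ij and with r and r'
   square roots of m_ij and m_ij + m. *)
Definition Bmx (m a : R) (r r' p q : C) : 'M[C]_2 :=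
  ((p - q) * r * r')^-1 *:
    mx2 (a%:C * (p - q) + m%:C * p)   (- (m%:C * p * q))
        m%:C                          (a%:C * (p - q) - m%:C * q).

Definition Cmx (mu s : R) (p : C) : 'M[C]_2 :=
  (1 - mu%:C * `|p| ^+ 2)^-1 *:
    mx2 (1 + s%:C * `|p| ^+ 2)        ((mu + s)%:C * p)
        ((mu + s)%:C * Num.conj p)    (s%:C + (mu ^+ 2)%:C * `|p| ^+ 2).

Definition Nmx (p : C) : 'M[C]_2 := mx2 (`|p| ^+ 2) p (Num.conj p) 1.

(* For u = (psi i, 1) and v = (psi j, 1), the matrix B_ij maps u v^* to
   sgn (m_ij (m_ij + m)) u v^* under X |-> B_ij X B_ij^*: conjugating
   sqrt m_ij sqrt (m_ij + m) produces a sign when this product is imaginary.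
   The signs e compensate for it, and they are constant precisely if
   m_ij (m_ij + m) > 0 on all edges. *)
Definition vertex_signs (m : R) ml (e : Z2 -> R) : Prop :=
  (forall i, e i = 1 \/ e i = -1) /\
  (forall i j, edge i j -> 0 < e i * e j * (ml i j * (ml i j + m))).

Definition weierstrass_data (mu m : R) psi ml r r' (Psi : Z2 -> 'M[C]_2)
    (e : Z2 -> R) : Prop :=
  [/\ discrete_holomorphic psi ml,
      m != 0 /\ (forall i j, edge i j -> ml i j + m != 0),
      edge_sqrt ml r /\ edge_sqrt (fun i j => ml i j + m) r',
      (forall i, \det (Psi i) = 1) /\
        (forall i j, edge i j ->
           Psi j = Psi i *m Bmx m (ml i j) (r i j) (r' i j) (psi i) (psi j)) &
      (forall i, mu%:C * `|psi i| ^+ 2 != 1) /\ vertex_signs m ml e].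

Definition weierstrass_surface (mu s : R) psi (Psi : Z2 -> 'M[C]_2)
    (e : Z2 -> R) (x : Z2 -> mink R) : Prop :=
  forall i, herm (x i) =
    (e i)%:C *: (Psi i *m Cmx mu s (psi i) *m adjoint (Psi i)).

Definition weierstrass_gauss psi (Psi : Z2 -> 'M[C]_2)
    (G : Z2 -> {vspace mink R}) : Prop :=
  forall i, exists2 v, G i = <[v]>%VS &
    herm v = Psi i *m Nmx (psi i) *m adjoint (Psi i).

End Weierstrass.

(* Main.v *)
(* For a pair write x = x^M and let h_i span G_i with (x_i, h_i) = 1.  Then
   x^+ = x - (mu + 1)/2 h and x^- = x - (mu - 1)/2 h, the Legendre condition says
   that x and h are edge-parallel, and the Weingarten equations of both surfaces
   reduce to A(x, h) = 0, that is, x and h are Christoffel dual.  With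
   s_ij = 1 - (h_i, x_j), duality means x_j - x_i = s_ij/(h_i, h_j) (h_i - h_j),
   s is equal on opposite edges and the lines G have the cross-ratio s_ij/s_il.

   Let v_i be a spinor of G_i.  The matrix T_ij with eigenvalue 1/w on v_i and w on
   v_j, where w^2 = t_ij = 1 - s_ij, maps x_i to x_j up to the sign of t_ij, and
   the cross-ratio condition is exactly the flatness of this connection.  In the
   frame Psi_j = T_ij Psi_i the point x becomes diag(1, -mu), the matrix T_ij becomes
   B_ij, and the spinors become (psi_i, 1), where psi has the cross-ratios
   m_il/m_ij with t_ij = m_ij/(m_ij + m).  Conversely, a parallel frame exists by
   flatness, and rotating it within the stabilizer of diag(1, -mu) keeps the
   countably many values of psi finite. *)

Require Import Defs.
From HB Require Import structures.
From mathcomp Require Import all_boot all_order all_algebra.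
From mathcomp Require Import complex boolp classical_sets reals.
From mathcomp Require Import zify ring lra.

Set Implicit Arguments.
Unset Strict Implicit.
Unset Printing Implicit Defensive.

Import Order.TTheory GRing.Theory Num.Theory.
Local Open Scope ring_scope.
Local Open Scope complex_scope.

(** * Null vectors and bivectors *)

(** Null vectors [u u^*] and [v v^*] have Minkowski product -|dt u v|^2/2, so products of null
    vectors see only the moduli |z| and |1 - z| of a cross-ratio z of four spinors. If z is to equal
    a given real number q, these moduli suffice: the circles around 0 and 1 through a real point q
    meet nowhere else. Hence the cross-ratio condition can be stated over the reals, by Gram
    products alone, and spinors, which carry an arbitrary scale at each vertex, enter only when a
    frame is built. The second obstacle is that w may be imaginary. Then X -> T X T^* carries x_i to
    -x_j, so signs have to be transported together with the frame. Even the sign at the origin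
    matters: for mu <= 0 the matrix diag(1, -mu) is semidefinite and its negative lies in another
    orbit of SL(2,C), whereas for mu > 0 both lie in the same orbit and the sign can be normalized.
    The strict sign condition on the labels has a second use: it keeps s and t away from 0 on every
    edge and separates the two labels of a face, so all divisions are legitimate. *)

Section Minkowski.

Variable R : realType.
Implicit Types (u v w a b c d : mink R) (x h : Z2 -> mink R).

Lemma mprodE u v : mprod u v = - (u 0 0 * v 0 0) + u 0 1 * v 0 1 +
  u 0 2%:R * v 0 2%:R + u 0 3%:R * v 0 3%:R.
Proof.
rewrite /mprod big_mkcond !big_ord_recl big_ord0 /= add0r addr0 !addrA.
by congr (_ + _ * _ + _ * _ + _ * _); congr (_ _ _); apply: val_inj.
Qed.

Lemma mprodC u v : mprod u v = mprod v u.
Proof. by rewrite !mprodE; ring. Qed.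

Lemma mprodDl u v w : mprod (u + v) w = mprod u w + mprod v w.
Proof. by rewrite !mprodE !mxE; ring. Qed.

Lemma mprodZl (k : R) u v : mprod (k *: u) v = k * mprod u v.
Proof. by rewrite !mprodE !mxE; ring. Qed.

Lemma mprodDr u v w : mprod u (v + w) = mprod u v + mprod u w.
Proof. by rewrite mprodC mprodDl !(mprodC u). Qed.

Lemma mprodZr (k : R) u v : mprod u (k *: v) = k * mprod u v.
Proof. by rewrite mprodC mprodZl mprodC. Qed.

Lemma mprodNl u v : mprod (- u) v = - mprod u v.
Proof. by rewrite -scaleN1r mprodZl mulN1r. Qed.

Lemma mprodNr u v : mprod u (- v) = - mprod u v.
Proof. by rewrite mprodC mprodNl mprodC. Qed.

Definition mprod_lin :=
  (mprodDl, mprodDr, mprodNl, mprodNr, mprodZl, mprodZr).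

Lemma mprod0l u : mprod 0 u = 0.
Proof. by rewrite -(scale0r u) mprodZl mul0r. Qed.

Lemma mink_eqP u v :
  u 0 0 = v 0 0 -> u 0 1 = v 0 1 -> u 0 2%:R = v 0 2%:R ->
  u 0 3%:R = v 0 3%:R -> u = v.
Proof.
move=> e0 e1 e2 e3; apply/rowP.
case=> [[|[|[|[|//]]]] lt4]; [move: e0|move: e1|move: e2|move: e3];
  by congr (u _ _ = v _ _); apply: val_inj.
Qed.

Lemma null_time_neq0 a : mprod a a = 0 -> a != 0 -> a 0 0 != 0.
Proof.
move=> aa; apply: contra_neq => a0; rewrite mprodE a0 in aa.
by apply: mink_eqP; rewrite ?a0 ?mxE //; nra.
Qed.

(* Equality case of the Cauchy-Schwarz inequality for the space parts. *)
Lemma null_orthogonal_parallel w a : mprod w w = 0 -> mprod a a = 0 ->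
  mprod w a = 0 -> a != 0 -> w = (w 0 0 / a 0 0) *: a.
Proof.
move=> ww aa wa /(null_time_neq0 aa) a0.
suff: a 0 0 *: w = w 0 0 *: a.
  by move=> e; apply: (scalerI a0); rewrite scalerA mulrC divfK.
have key : (a 0 0 * w 0 1 - w 0 0 * a 0 1) ^+ 2 +
  ((a 0 0 * w 0 2%:R - w 0 0 * a 0 2%:R) ^+ 2 +
   (a 0 0 * w 0 3%:R - w 0 0 * a 0 3%:R) ^+ 2) = 0.
  transitivity (a 0 0 ^+ 2 * mprod w w - 2%:R * a 0 0 * w 0 0 * mprod w a +
    w 0 0 ^+ 2 * mprod a a); first by rewrite !mprodE; ring.
  by rewrite ww aa wa; ring.
move/eqP: key; rewrite !paddr_eq0 ?addr_ge0 ?sqr_ge0 // !sqrf_eq0 !subr_eq0.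
by case/and3P=> /eqP e1 /eqP e2 /eqP e3; apply: mink_eqP; rewrite !mxE // mulrC.
Qed.

Lemma mprod_neq0l a b : mprod a b != 0 -> a != 0.
Proof. by apply: contra_neq => ->; rewrite mprod0l. Qed.

(** Orthogonal null vectors are parallel, so [w] is a multiple of [a]; pairing with [b] shows that
    the factor is 0. *)
Lemma null_orthogonal2_eq0 w a b : mprod w w = 0 -> mprod a a = 0 ->
  mprod w a = 0 -> mprod w b = 0 -> mprod a b != 0 -> w = 0.
Proof.
move=> ww aa wa wb ab.
have we := null_orthogonal_parallel ww aa wa (mprod_neq0l ab).
move: wb; rewrite we mprodZl => /eqP; rewrite mulf_eq0 (negPf ab) orbF => /eqP ->.
by rewrite scale0r.
Qed.

(** The Gram determinant of three null vectors is 2 (a,b)(b,c)(a,c). The combinations in the proof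
    apply the adjugate of the Gram matrix to the relation. *)
Lemma null_independent a b c (p q r : R) :
  mprod a a = 0 -> mprod b b = 0 -> mprod c c = 0 ->
  mprod a b != 0 -> mprod b c != 0 -> mprod a c != 0 ->
  p *: a + q *: b + r *: c = 0 -> [/\ p = 0, q = 0 & r = 0].
Proof.
move=> aa bb cc ab bc ac rel.
have ea : q * mprod a b + r * mprod a c = 0.
  by have := congr1 (mprod a) rel; rewrite !mprod_lin aa (mprodC a 0) mprod0l; lra.
have eb : p * mprod a b + r * mprod b c = 0.
  have := congr1 (mprod b) rel.
  by rewrite !mprod_lin bb (mprodC b a) (mprodC b 0) mprod0l; lra.
have ec : p * mprod a c + q * mprod b c = 0.
  have := congr1 (mprod c) rel.
  by rewrite !mprod_lin cc (mprodC c a) (mprodC c b) (mprodC c 0) mprod0l; lra.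
have two : (2%:R : R) != 0 by rewrite pnatr_eq0.
split; apply/eqP.
- have : p * (2%:R * mprod a b * mprod a c) = 0.
    transitivity (mprod a c * (p * mprod a b + r * mprod b c) +
      mprod a b * (p * mprod a c + q * mprod b c) -
      mprod b c * (q * mprod a b + r * mprod a c)); first by ring.
    by rewrite ea eb ec; ring.
  by move/eqP; rewrite !mulf_eq0 (negPf two) (negPf ab) (negPf ac) !orbF.
- have : q * (2%:R * mprod a b * mprod b c) = 0.
    transitivity (mprod b c * (q * mprod a b + r * mprod a c) +
      mprod a b * (p * mprod a c + q * mprod b c) -
      mprod a c * (p * mprod a b + r * mprod b c)); first by ring.
    by rewrite ea eb ec; ring.
  by move/eqP; rewrite !mulf_eq0 (negPf two) (negPf ab) (negPf bc) !orbF.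
- have : r * (2%:R * mprod a c * mprod b c) = 0.
    transitivity (mprod b c * (q * mprod a b + r * mprod a c) +
      mprod a c * (p * mprod a b + r * mprod b c) -
      mprod a b * (p * mprod a c + q * mprod b c)); first by ring.
    by rewrite ea eb ec; ring.
  by move/eqP; rewrite !mulf_eq0 (negPf two) (negPf ac) (negPf bc) !orbF.
Qed.

Lemma wedgeE u v k l : wedge u v k l = u 0 k * v 0 l - v 0 k * u 0 l.
Proof. by rewrite !mxE !big_ord1 !mxE. Qed.

Lemma wedgeZl (k : R) u v : wedge (k *: u) v = k *: wedge u v.
Proof. by apply/matrixP=> p q; rewrite [RHS]mxE !wedgeE !mxE; ring. Qed.

Lemma wedgeZr (k : R) u v : wedge u (k *: v) = k *: wedge u v.
Proof. by apply/matrixP=> p q; rewrite [RHS]mxE !wedgeE !mxE; ring. Qed.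

Lemma wedgexx u : wedge u u = 0.
Proof. by rewrite /wedge subrr. Qed.

Lemma wedge_eq0_parallel u v : wedge u v = 0 -> u != 0 -> exists k, v = k *: u.
Proof.
move=> uv /rV0Pn [p up]; exists (v 0 p / u 0 p); apply/rowP=> q; rewrite mxE.
have := congr1 (fun A : 'M_4 => A p q) uv; rewrite wedgeE !mxE => /eqP.
rewrite subr_eq0 => /eqP e; apply: (mulfI up); rewrite e mulrA.
by rewrite (mulrC (u 0 p)) divfK.
Qed.

(* Add the vanishing products of corresponding edges with alternating signs. *)
Lemma edge_parallel_diagonals x h i j k l (c1 c2 c3 c4 : R) :
  x j - x i = c1 *: (h i - h j) -> x k - x j = c2 *: (h j - h k) ->
  x l - x k = c3 *: (h k - h l) -> x i - x l = c4 *: (h l - h i) ->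
  wedge (x i - x k) (h j - h l) = - wedge (x j - x l) (h i - h k).
Proof.
move=> e1 e2 e3 e4; apply/matrixP=> p q.
have par (y z : mink R) (s : R) : y = s *: z -> y 0 p * z 0 q - z 0 p * y 0 q = 0.
  by move=> ->; rewrite !mxE; ring.
have := par _ _ _ e1; have := par _ _ _ e2; have := par _ _ _ e3.
have := par _ _ _ e4 => f4 f3 f2 f1.
rewrite [RHS]mxE !wedgeE; rewrite !mxE in f1 f2 f3 f4 *.
apply/eqP; rewrite -subr_eq0; apply/eqP.
transitivity (
 ((x j 0 p - x i 0 p) * (h i 0 q - h j 0 q) - (h i 0 p - h j 0 p) * (x j 0 q - x i 0 q))
 - ((x k 0 p - x j 0 p) * (h j 0 q - h k 0 q) - (h j 0 p - h k 0 p) * (x k 0 q - x j 0 q))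
 + ((x l 0 p - x k 0 p) * (h k 0 q - h l 0 q) - (h k 0 p - h l 0 p) * (x l 0 q - x k 0 q))
 - ((x i 0 p - x l 0 p) * (h l 0 q - h i 0 q) - (h l 0 p - h i 0 p) * (x i 0 q - x l 0 q))).
  ring.
rewrite f1 f2 f3 f4; ring.
Qed.

Lemma mixed_areaxx x i j k l :
  mixed_area x x i j k l = 2%:R^-1 *: wedge (x i - x k) (x j - x l).
Proof.
apply/matrixP=> p q; by rewrite !mxE !big_ord1 !mxE; field.
Qed.

(** Read a, b, c, d as the vectors h around a face and [v] as the diagonal x_k - x_i, reached along
    the two sides of the face. The conclusion is the criterion for Christoffel duality, obtained
    from the Gram form of the cross-ratio condition; [dual_face_gram] is the way back. *)
Lemma diagonal_parallel a b c d v (c1 c2 c1' c2' s1 s2 : R) :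
  mprod a a = 0 -> mprod b b = 0 -> mprod c c = 0 -> mprod d d = 0 ->
  c1 * mprod a b = s1 -> c2 * mprod b c = s2 ->
  c1' * mprod c d = s1 -> c2' * mprod a d = s2 ->
  s1 != 0 -> s2 != 0 -> s1 != s2 ->
  mprod a b * mprod c d * s2 ^+ 2 = mprod a d * mprod b c * s1 ^+ 2 ->
  mprod a c * mprod b d * s2 ^+ 2 = mprod a d * mprod b c * (s1 - s2) ^+ 2 ->
  v = c1 *: (a - b) + c2 *: (b - c) -> v = c2' *: (a - d) + c1' *: (d - c) ->
  exists k, v = k *: (b - d).
Proof.
move=> aa bb cc dd e1 e2 e1' e2' s10 s20 s12 g1 g2 v1 v2.
have ne0 (p q s : R) : p * q = s -> s != 0 -> p != 0 /\ q != 0.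
  by move=> <-; rewrite mulf_eq0 negb_or => /andP.
have [c10 ab] := ne0 _ _ _ e1 s10; have [c20 bc] := ne0 _ _ _ e2 s20.
have [c10' cd] := ne0 _ _ _ e1' s10; have [c20' ad] := ne0 _ _ _ e2' s20.
(* This is the first Gram condition [g1], divided by the products of a, b, c, d on the edges. *)
have cc12 : c1 * c1' = c2 * c2'.
  have ne : mprod a b * mprod c d * mprod a d * mprod b c != 0.
    by rewrite !mulf_eq0 !negb_or ab cd ad.
  apply: (mulIf ne).
  transitivity (mprod a d * mprod b c * ((c1 * mprod a b) * (c1' * mprod c d))); first by ring.
  transitivity (mprod a b * mprod c d * ((c2 * mprod b c) * (c2' * mprod a d))); last by ring.
  by rewrite e1 e1' e2 e2' -!expr2 g1.
(* Eliminating [a] and [c] from the two expressions of [v] works unless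
   [c1 = c2']; then all coefficients agree and the Gram conditions make
   [a - c] and [b - d] parallel, because [w = a - c - t (b - d)] is a null
   vector orthogonal to the independent null vectors [a] and [b]. *)
have [ec|nc] := eqVneq c2' c1; last first.
  have dn : c2' - c1 != 0 by rewrite subr_eq0.
  exists (c2' * (c2 - c1) / (c2' - c1)).
  apply: (scalerI dn); rewrite scalerA mulrC divfK //.
  transitivity (c2' *: (c1 *: (a - b) + c2 *: (b - c)) -
                c1 *: (c2' *: (a - d) + c1' *: (d - c))).
    by rewrite -v1 -v2 scalerBl.
  apply/rowP=> p; rewrite !mxE.
  transitivity ((c2 * c2' - c2' * c1) * b 0 p - (c1 * c1' - c1 * c2') * d 0 p +
     (c1 * c1' - c2 * c2') * c 0 p); first ring.
  rewrite cc12; ring.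
subst c2'.
have ec' : c1' = c2 by apply: (mulfI c10); rewrite cc12 mulrC.
subst c1'.
have bd : mprod b d != 0.
  apply: contraNneq s12 => bd; move: g2; rewrite bd mulr0 mul0r => /esym/eqP.
  by rewrite mulf_eq0 sqrf_eq0 subr_eq0 mulf_eq0 (negPf ad) (negPf bc).
have ec : c1 = c2.
  have : (c1 - c2) *: (b - d) = 0.
    have: c1 *: (a - b) + c2 *: (b - c) - (c1 *: (a - d) + c2 *: (d - c)) = 0.
      by rewrite -v1 -v2 subrr.
    move=> E; apply/rowP=> p; have := congr1 (fun z : mink R => z 0 p) E.
    by rewrite !mxE; lra.
  move/eqP; rewrite scaler_eq0 => /orP [|/eqP bd0]; first by rewrite subr_eq0 => /eqP.
  by move: bd; rewrite -(subrK d b) bd0 add0r dd eqxx.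
subst c2.
(* The value that makes a - c - t (b - d) orthogonal to [b]. *)
set t := (mprod b c - mprod a b) / mprod b d.
have tE : t * mprod b d = mprod b c - mprod a b by rewrite /t divfK.
have E1 : mprod c d = mprod a b by apply: (mulfI c10); rewrite e1 e1'.
have E2 : mprod a d = mprod b c by apply: (mulfI c10); rewrite e2 e2'.
have E3 : mprod a c = t * (mprod b c - mprod a b).
  apply: (mulIf bd); rewrite mulrAC tE.
  have s2n : s2 ^+ 2 != 0 by rewrite expf_neq0.
  apply: (mulIf s2n); rewrite g2 E2 -e1 -e2; ring.
have : a - c - t *: (b - d) = 0.
  have [ba [ca [da [cb [db dc]]]]] := (mprodC b a, (mprodC c a, (mprodC d a,
    (mprodC c b, (mprodC d b, mprodC d c))))).
  apply: (@null_orthogonal2_eq0 _ a b) => //;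
   rewrite !mprod_lin ?aa ?bb ?cc ?dd ?ba ?ca ?da ?cb ?db ?dc ?E1 ?E2 ?E3.
  - transitivity (2%:R * t * (mprod b c - mprod a b - t * mprod b d)); first ring.
    rewrite tE; ring.
  - ring.
  - transitivity (t * mprod b d - (mprod b c - mprod a b)); first ring.
    by rewrite tE subrr.
move/eqP; rewrite subr_eq0 => /eqP E; exists (c1 * t).
by rewrite v1 -scalerDr addrA subrK E scalerA.
Qed.

End Minkowski.

(** * Faces of edge-parallel surfaces *)

Section Faces.

Variable R : realType.
Implicit Types (u v w a b c d : mink R) (x h y n : Z2 -> mink R).

Definition in_plane (P Q u : mink R) := exists p q : R, u = p *: P + q *: Q.

Lemma in_planeB P Q u v : in_plane P Q u -> in_plane P Q v -> in_plane P Q (u - v).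
Proof.
move=> [p [q ->]] [p' [q' ->]]; exists (p - p'), (q - q').
by rewrite !scalerBl opprD addrACA.
Qed.

Lemma in_planeZ P Q u (k : R) : in_plane P Q u -> in_plane P Q (k *: u).
Proof.
by move=> [p [q ->]]; exists (k * p), (k * q); rewrite scalerDr !scalerA.
Qed.

Lemma in_plane_span P Q u : in_plane P Q u -> u \in <<[:: P; Q]>>%VS.
Proof.
by move=> [p [q ->]]; rewrite memvD ?memvZ ?memv_span ?inE ?eqxx ?orbT.
Qed.

Lemma wedge_plane P Q u v : in_plane P Q u -> in_plane P Q v ->
  exists t, wedge u v = t *: wedge P Q.
Proof.
move=> [p [q ->]] [p' [q' ->]]; exists (p * q' - q * p').
by apply/matrixP=> e f; rewrite [RHS]mxE !wedgeE !mxE; ring.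
Qed.

Definition face_in_plane P Q y (i j k l : Z2) :=
  [/\ in_plane P Q (y j - y i), in_plane P Q (y k - y i) &
      in_plane P Q (y l - y i)].

Lemma mixed_area_plane P Q y n i j k l :
  face_in_plane P Q y i j k l -> face_in_plane P Q n i j k l ->
  exists t, mixed_area y n i j k l = t *: wedge P Q.
Proof.
have diags z : face_in_plane P Q z i j k l ->
    in_plane P Q (z i - z k) /\ in_plane P Q (z j - z l).
  move=> [zj zk zl]; split.
    by rewrite -opprB -scaleN1r; apply: in_planeZ.
  by have := in_planeB zj zl; rewrite opprB addrA subrK.
move=> /diags [y1 y2] /diags [n1 n2].
have [s sE] := wedge_plane y1 n2; have [t tE] := wedge_plane y2 n1.
by exists (4%:R^-1 * (s - t)); rewrite /mixed_area sE tE -scalerBl scalerA.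
Qed.

Lemma face_in_plane_planar P Q y i j k l : face_in_plane P Q y i j k l ->
  (\dim <<[:: (y j - y i)%R; (y k - y i)%R; (y l - y i)%R]>>%VS <= 2)%N.
Proof.
move=> [yj yk yl]; apply: leq_trans (dim_span [:: P; Q]).
apply/dimvS/span_subvP => z; rewrite !inE.
by case/or3P=> /eqP ->; apply: in_plane_span.
Qed.

Lemma mixed_areaE x y i j k l p q : mixed_area x y i j k l p q =
  4%:R^-1 * ((x i 0 p - x k 0 p) * (y j 0 q - y l 0 q) -
    (y j 0 p - y l 0 p) * (x i 0 q - x k 0 q) -
   ((x j 0 p - x l 0 p) * (y i 0 q - y k 0 q) -
    (y i 0 p - y k 0 p) * (x j 0 q - x l 0 q))).
Proof. by rewrite [LHS]mxE [X in _ * X]mxE wedgeE [X in _ + X]mxE wedgeE !mxE. Qed.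

(** The mixed area is bilinear and symmetric, and this combination kills A(x,x) and A(h,h); the
    coefficient left on A(x,h) is (p + q)^2 - 4pq. For p = (mu + s)/2 and q = (mu - s)/2 the left
    side is half the Weingarten expression times A(y,y), and p - q = s. *)
Lemma weingarten_mixed_area (p q : R) x h y n i j k l :
  (forall z, y z = x z - p *: h z) -> (forall z, n z = - x z + q *: h z) ->
  p *: mixed_area n n i j k l + (p + q) *: mixed_area y n i j k l +
    q *: mixed_area y y i j k l = (p - q) ^+ 2 *: mixed_area x h i j k l.
Proof.
move=> yE nE; apply/matrixP=> e f.
have yE' z g : y z 0 g = x z 0 g - p * h z 0 g by rewrite yE !mxE.
have nE' z g : n z 0 g = - x z 0 g + q * h z 0 g by rewrite nE !mxE.
rewrite [LHS]mxE [in LHS]mxE [X in X + _ + _]mxE [X in _ + X + _]mxE [X in _ + X]mxE.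
rewrite [RHS]mxE !mixed_areaE !yE' !nE'.
move: (x i 0 e) (x j 0 e) (x k 0 e) (x l 0 e) (x i 0 f) (x j 0 f) (x k 0 f)
  (x l 0 f) (h i 0 e) (h j 0 e) (h k 0 e) (h l 0 e) (h i 0 f) (h j 0 f)
  (h k 0 f) (h l 0 f) (4%:R^-1) => *.
ring.
Qed.

(** For edge-parallel nets both terms of the mixed area agree, so A(x,h) = 0 says exactly that a
    diagonal of x is parallel to the opposite diagonal of h. *)
Lemma mixed_area_dual x h i j k l (c1 c2 c3 c4 : R) :
  x j - x i = c1 *: (h i - h j) -> x k - x j = c2 *: (h j - h k) ->
  x l - x k = c3 *: (h k - h l) -> x i - x l = c4 *: (h l - h i) ->
  mixed_area x h i j k l = 2%:R^-1 *: wedge (x i - x k) (h j - h l).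
Proof.
move=> e1 e2 e3 e4; rewrite /mixed_area.
rewrite -[X in _ - X]opprK -(edge_parallel_diagonals e1 e2 e3 e4) opprK.
by rewrite -mulr2n -scaler_nat scalerA; congr (_ *: _); field.
Qed.

(** Since pa + qb = -(rc + sd), both sides have the same square, and for null vectors these squares
    are 2pq (a,b) and 2rs (c,d). The second identity groups [a] with [d]. *)
Lemma relation_gram a b c d (p q r s : R) :
  mprod a a = 0 -> mprod b b = 0 -> mprod c c = 0 -> mprod d d = 0 ->
  p *: a + q *: b + r *: c + s *: d = 0 ->
  p * q * mprod a b = r * s * mprod c d /\ p * s * mprod a d = q * r * mprod b c.
Proof.
move=> aa bb cc dd rel.
have [ba [ca [da [cb [db dc]]]]] := (mprodC b a, (mprodC c a, (mprodC d a,
    (mprodC c b, (mprodC d b, mprodC d c))))).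
have prod v : p * mprod a v + q * mprod b v + r * mprod c v + s * mprod d v = 0.
  by rewrite -(mprod0l v) -rel !mprod_lin.
have := prod a; have := prod b; have := prod c; have := prod d.
rewrite aa bb cc dd ba ca da cb db dc.
move: (mprod a b) (mprod a c) (mprod a d) (mprod b c) (mprod b d) (mprod c d).
move=> ab ac ad bc bd cd ed ec eb ea; split.
- have two : (2%:R : R) != 0 by rewrite pnatr_eq0.
  apply: (mulfI two); apply/eqP; rewrite -subr_eq0; apply/eqP.
  transitivity (p * (p * 0 + q * ab + r * ac + s * ad) +
    q * (p * ab + q * 0 + r * bc + s * bd) -
    r * (p * ac + q * bc + r * 0 + s * cd) -
    s * (p * ad + q * bd + r * cd + s * 0)); first ring.
  by rewrite ea eb ec ed; ring.
- have two : (2%:R : R) != 0 by rewrite pnatr_eq0.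
  apply: (mulfI two); apply/eqP; rewrite -subr_eq0; apply/eqP.
  transitivity (p * (p * 0 + q * ab + r * ac + s * ad) -
    q * (p * ab + q * 0 + r * bc + s * bd) -
    r * (p * ac + q * bc + r * 0 + s * cd) +
    s * (p * ad + q * bd + r * cd + s * 0)); first ring.
  by rewrite ea eb ec ed; ring.
Qed.

(* The hypotheses give three linear relations between the null vectors [a], [b],
   [c], [d]; as any three of these are independent, the relations are
   proportional, which determines the ratios of all coefficients. *)
Lemma dual_face_gram a b c d (c1 c2 c1' c2' l k : R) :
  mprod a a = 0 -> mprod b b = 0 -> mprod c c = 0 -> mprod d d = 0 ->
  mprod a b != 0 -> mprod a c != 0 -> mprod a d != 0 ->
  mprod b c != 0 -> mprod b d != 0 -> mprod c d != 0 ->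
  c1 != 0 -> c2 != 0 -> c1' != 0 -> c2' != 0 ->
  c1 *: (a - b) + c2 *: (b - c) = l *: (b - d) ->
  c2' *: (a - d) + c1' *: (d - c) = l *: (b - d) ->
  c2' *: (a - d) - c1 *: (a - b) = k *: (a - c) ->
  [/\ c1 * mprod a b = c1' * mprod c d, c2 * mprod b c = c2' * mprod a d,
  mprod a b * mprod c d * (c2 * mprod b c) ^+ 2 =
    mprod a d * mprod b c * (c1 * mprod a b) ^+ 2 &
  mprod a c * mprod b d * (c2 * mprod b c) ^+ 2 =
    mprod a d * mprod b c * (c1 * mprod a b - c2 * mprod b c) ^+ 2].
Proof.
move=> aa bb cc dd ab ac ad bc bd cd c10 c20 c10' c20' r1 r2 r3.
have R1 e : c1 * a 0 e + (c2 - c1 - l) * b 0 e - c2 * c 0 e + l * d 0 e = 0.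
  by have := congr1 (fun v : mink R => v 0 e) r1; rewrite !mxE; lra.
have R2 e : c2' * a 0 e - l * b 0 e - c1' * c 0 e + (c1' - c2' + l) * d 0 e = 0.
  by have := congr1 (fun v : mink R => v 0 e) r2; rewrite !mxE; lra.
have R3 e : (c2' - c1 - k) * a 0 e + c1 * b 0 e + k * c 0 e - c2' * d 0 e = 0.
  by have := congr1 (fun v : mink R => v 0 e) r3; rewrite !mxE; lra.
(* Here c2' R1 - c1 R2 eliminates [a], leaving a trivial relation between [b], [c], [d]; below, c2'
   R1 + l R3 eliminates [d]. *)
have m12 : c1 * c1' = c2 * c2'.
  have [|_ + _] := @null_independent _ b c d (c2' * (c2 - c1 - l) + c1 * l)
    (c1 * c1' - c2' * c2) (c2' * l - c1 * (c1' - c2' + l)) bb cc dd bc cd bd.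
    apply/rowP=> e; rewrite !mxE.
    by transitivity (c2' * 0 - c1 * 0 : R); [rewrite -{1}(R1 e) -(R2 e)|]; ring.
  by move/eqP; rewrite subr_eq0 mulrC => /eqP ->; rewrite mulrC.
have [m13a m13b] : c2 * c2' = l * k /\ c2' * (c2 - c1 - l) = - (l * c1).
  have [|_ f g] := @null_independent _ a b c
      (c2' * c1 + l * (c2' - c1 - k)) (c2' * (c2 - c1 - l) + l * c1)
      (l * k - c2' * c2) aa bb cc ab bc ac.
    apply/rowP=> e; rewrite !mxE.
    by transitivity (c2' * 0 + l * 0 : R); [rewrite -{1}(R1 e) -(R3 e)|]; ring.
  split; last by apply/eqP; rewrite -addr_eq0 f.
  by move/eqP: g; rewrite subr_eq0 mulrC => /eqP ->; rewrite mulrC.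
have lk0 : l * k != 0 by rewrite -m13a mulf_neq0.
have [l0 k0] : l != 0 /\ k != 0 by apply/andP; rewrite -negb_or -mulf_eq0.
have m13c : (c2 - c1 - l) * k = - (c2 * c1).
  apply: (mulfI c20'); rewrite mulrA m13b mulNr mulrN; congr (- _).
  by rewrite mulrAC -m13a; ring.
have R1v : c1 *: a + (c2 - c1 - l) *: b + (- c2) *: c + l *: d = 0.
  by apply/rowP=> e; rewrite !mxE mulNr -(R1 e).
have [g1 g2] := relation_gram aa bb cc dd R1v.
have E1 : c1 * mprod a b = c1' * mprod c d.
  apply: (mulfI c10); apply: (mulfI c20).
  apply: (@mulfI _ (-1)); first by rewrite oppr_eq0 oner_eq0.
  transitivity (k * (c1 * (c2 - c1 - l) * mprod a b)).
    transitivity (c1 * ((c2 - c1 - l) * k) * mprod a b); last ring.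
    rewrite m13c; ring.
  rewrite g1; transitivity (- c2 * (l * k) * mprod c d); first ring.
  by rewrite -m13a -m12; ring.
have E2 : c2 * mprod b c = c2' * mprod a d.
  have c1l : c1 * l != 0 by rewrite mulf_neq0.
  apply: (mulfI c1l); transitivity (c2' * (c1 * l * mprod a d)); last ring.
  rewrite g2; transitivity (- (c2' * (c2 - c1 - l)) * c2 * mprod b c); last ring.
  rewrite m13b; ring.
have [ba [ca [da [cb [db dc]]]]] := (mprodC b a, (mprodC c a, (mprodC d a,
    (mprodC c b, (mprodC d b, mprodC d c))))).
have E3 : l * mprod b d = c2 * mprod b c - c1 * mprod a b.
  have := congr1 (mprod b) r1; rewrite !mprod_lin bb ba => /esym f.
  by transitivity (- (l * (0 + - mprod b d))); [|rewrite f]; ring.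
have E4 : k * mprod a c = c2' * mprod a d - c1 * mprod a b.
  have := congr1 (mprod a) r3; rewrite !mprod_lin aa => f; apply/eqP.
  by rewrite -eqr_opp -mulrN -[- mprod a c]add0r -f; apply/eqP; ring.
split=> //.
- rewrite {1}expr2 {1}E2 [in RHS]expr2 [in X in _ = _ * (X * _)]E1.
  transitivity (c2 * c2' * (mprod a b * mprod c d * mprod a d * mprod b c)).
    ring.
  rewrite -m12; ring.
- rewrite {1}expr2 {1}E2.
  transitivity (c2 * c2' * mprod a c * mprod b d * (mprod a d * mprod b c)).
    ring.
  rewrite m13a; transitivity ((k * mprod a c) * (l * mprod b d) * (mprod a d * mprod b c)).
    ring.
  rewrite E3 E4 -E2; ring.
Qed.

(** If (b,d) = 0, then d = r b. For r = 1 the vector [u] is a multiple of a - b and cannot be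
    parallel to a - c. For r != 1 the vector b - d is a nonzero multiple of [b], while [v] has the
    nonzero component c1 along [a]. Both contradict the independence of [a], [b], [c]. *)
Lemma dual_face_diagonal_neq0 a b c d u v (c1 c2 c2' : R) :
  mprod a a = 0 -> mprod b b = 0 -> mprod c c = 0 -> mprod d d = 0 ->
  mprod a b != 0 -> mprod b c != 0 -> mprod a c != 0 -> c1 != 0 ->
  v = c1 *: (a - b) + c2 *: (b - c) -> u = c2' *: (a - d) - c1 *: (a - b) ->
  v != 0 -> u != 0 -> wedge v (b - d) = 0 -> wedge u (a - c) = 0 ->
  mprod b d != 0.
Proof.
move=> aa bb cc dd ab bc ac c10 vE uE v0 u0 vw uw; apply/eqP=> bd.
have b0 := mprod_neq0l bc.
have := null_orthogonal_parallel dd bb _ b0; rewrite mprodC => /(_ bd).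
set r := _ / _ => dE; have [r1|r1] := eqVneq r 1.
  have [k kE] := wedge_eq0_parallel uw u0.
  rewrite r1 scale1r in dE; rewrite dE in uE.
  have [|_ _] := @null_independent _ a b c (1 - k * (c2' - c1)) (k * (c2' - c1)) (-1)
    aa bb cc ab bc ac.
    rewrite -[RHS](subrr (a - c)) {2}kE uE.
    by apply/rowP=> e; rewrite !mxE; ring.
  by move/eqP; rewrite oppr_eq0 oner_eq0.
have [k kE] := wedge_eq0_parallel vw v0.
have k0 : k != 0.
  apply: contra_neq r1 => k0; move: kE; rewrite k0 scale0r dE -{1}[b]scale1r -scalerBl.
  by move/eqP; rewrite scaler_eq0 (negPf b0) orbF subr_eq0 eq_sym => /eqP.
have [|/eqP + _ _] := @null_independent _ a b c (k * c1) (k * (c2 - c1) - (1 - r))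
    (- (k * c2)) aa bb cc ab bc ac.
  rewrite -[RHS](subrr (k *: v)) -{2}kE dE vE.
  by apply/rowP=> e; rewrite !mxE; ring.
by rewrite mulf_eq0 (negPf k0) (negPf c10).
Qed.

End Faces.

(** * Spinors *)

Section SpinorAlgebra.

Variable C : fieldType.
Implicit Types (u v a b c d : 'cV[C]_2) (A B T : 'M[C]_2).

Lemma mulmx2E (m n : nat) (A : 'M[C]_(m, 2)) (B : 'M[C]_(2, n)) p q :
  (A *m B) p q = A p 0 * B 0 q + A p 1 * B 1 q.
Proof.
rewrite mxE !big_ord_recl big_ord0 addr0.
by congr (_ + A p _ * B _ q); apply: val_inj.
Qed.

Lemma mx2_eqP A B : A 0 0 = B 0 0 -> A 0 1 = B 0 1 -> A 1 0 = B 1 0 ->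
  A 1 1 = B 1 1 -> A = B.
Proof.
move=> e00 e01 e10 e11; apply/matrixP.
case=> [[|[|//]] p] [[|[|//]] q]; [move: e00|move: e01|move: e10|move: e11];
  by congr (A _ _ = B _ _); apply: val_inj.
Qed.

Lemma spinor_eqP u v : u 0 0 = v 0 0 -> u 1 0 = v 1 0 -> u = v.
Proof.
move=> e0 e1; apply/colP; case=> [[|[|//]] p]; [move: e0|move: e1];
  by congr (u _ _ = v _ _); apply: val_inj.
Qed.

Lemma mx2_00 (p q r s : C) : mx2 p q r s 0 0 = p. Proof. by rewrite mxE. Qed.
Lemma mx2_01 (p q r s : C) : mx2 p q r s 0 1 = q. Proof. by rewrite mxE. Qed.
Lemma mx2_10 (p q r s : C) : mx2 p q r s 1 0 = r. Proof. by rewrite mxE. Qed.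
Lemma mx2_11 (p q r s : C) : mx2 p q r s 1 1 = s. Proof. by rewrite mxE. Qed.
Definition mx2_entries := (mx2_00, mx2_01, mx2_10, mx2_11).

Lemma det_mx2E A : \det A = A 0 0 * A 1 1 - A 0 1 * A 1 0.
Proof.
rewrite (expand_det_row _ 0) !big_ord_recl big_ord0 addr0 /cofactor !det_mx11 !mxE /=.
rewrite expr0 expr1 mul1r mulN1r mulrN.
by congr (A _ _ * A _ _ - A _ _ * A _ _); apply: val_inj.
Qed.

(** The polar form of the determinant: [bil A A] is 2 det A. *)
Definition bil A B : C := A 0 0 * B 1 1 + A 1 1 * B 0 0 - A 0 1 * B 1 0 - A 1 0 * B 0 1.

(** The area form on spinors, the determinant of the matrix with columns [u] and [v]. *)
Definition dt u v : C := u 0 0 * v 1 0 - u 1 0 * v 0 0.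

Lemma dtC u v : dt u v = - dt v u.
Proof. by rewrite /dt; ring. Qed.

Lemma dtxx u : dt u u = 0.
Proof. by rewrite /dt; ring. Qed.

Lemma dtZl (k : C) u v : dt (k *: u) v = k * dt u v.
Proof. by rewrite /dt !mxE; ring. Qed.

Lemma dtZr (k : C) u v : dt u (k *: v) = k * dt u v.
Proof. by rewrite /dt !mxE; ring. Qed.

Lemma dt_mul A u v : dt (A *m u) (A *m v) = \det A * dt u v.
Proof. by rewrite /dt !mulmx2E det_mx2E; ring. Qed.

(** The three-term Plücker relation; it expresses z - 1, for a cross-ratio z, through the diagonals
    of the quadrilateral. *)
Lemma dt_plucker a b c d : dt a c * dt b d = dt a b * dt c d - dt b c * dt d a.
Proof. by rewrite /dt; ring. Qed.

Lemma spinor_basis_eq A B u v : dt u v != 0 -> A *m u = B *m u ->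
  A *m v = B *m v -> A = B.
Proof.
move=> uv eu ev.
have row p : A p 0 = B p 0 /\ A p 1 = B p 1.
  have := congr1 (fun z : 'cV_2 => z p 0) eu.
  have := congr1 (fun z : 'cV_2 => z p 0) ev; rewrite !mulmx2E => fv fu.
  split; apply: (mulIf uv); rewrite /dt.
    transitivity ((A p 0 * u 0 0 + A p 1 * u 1 0) * v 1 0 -
                  (A p 0 * v 0 0 + A p 1 * v 1 0) * u 1 0); first ring.
    by rewrite fu fv; ring.
  transitivity ((A p 0 * v 0 0 + A p 1 * v 1 0) * u 0 0 -
                (A p 0 * u 0 0 + A p 1 * u 1 0) * v 0 0); first ring.
  by rewrite fu fv; ring.
by have [? ?] := row 0; have [? ?] := row 1; apply: mx2_eqP.
Qed.

(* The projection onto the line of v along u. *)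
Definition spinor_proj u v : 'M[C]_2 := (dt u v)^-1 *:
  mx2 (- (v 0 0 * u 1 0)) (v 0 0 * u 0 0) (- (v 1 0 * u 1 0)) (v 1 0 * u 0 0).

(* The matrix with eigenvalues 1 / w on u and w on v. *)
Definition boost (w : C) u v : 'M[C]_2 :=
  w^-1 *: (1%:M - (1 - w ^+ 2) *: spinor_proj u v).

Lemma spinor_projE u v p : spinor_proj u v p 0 = (dt u v)^-1 * - (v p 0 * u 1 0)
  /\ spinor_proj u v p 1 = (dt u v)^-1 * (v p 0 * u 0 0).
Proof.
by case: p => [[|[|//]] ?]; split; rewrite mxE mxE; congr (_ * _);
  rewrite /=; do ?congr (- _); congr (v _ _ * _); apply: val_inj.
Qed.

Lemma spinor_proj_mul u v a : spinor_proj u v *m a = (dt u a / dt u v) *: v.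
Proof.
by apply: spinor_eqP; rewrite mulmx2E !(spinor_projE _ _ _).1 !(spinor_projE _ _ _).2 mxE
  /dt; ring.
Qed.

Lemma boost_mul w u v a :
  boost w u v *m a = w^-1 *: (a - ((1 - w ^+ 2) * (dt u a / dt u v)) *: v).
Proof.
by rewrite -scalemxAl mulmxBl mul1mx -scalemxAl spinor_proj_mul scalerA.
Qed.

Lemma boost_fst w u v : boost w u v *m u = w^-1 *: u.
Proof.
by rewrite boost_mul dtxx mul0r mulr0 scale0r subr0.
Qed.

Lemma boost_snd w u v : w != 0 -> dt u v != 0 -> boost w u v *m v = w *: v.
Proof.
move=> w0 uv; rewrite boost_mul divff // mulr1 scalerBl scale1r opprB addrC subrK.
by rewrite scalerA; congr (_ *: _); field.
Qed.

Lemma boost_unique w u v T : w != 0 -> dt u v != 0 ->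
  T *m u = w^-1 *: u -> T *m v = w *: v -> T = boost w u v.
Proof.
move=> w0 uv eu ev; apply: (spinor_basis_eq uv); first by rewrite boost_fst.
by rewrite boost_snd.
Qed.

Lemma boostZ w (k l : C) u v : w != 0 -> k != 0 -> l != 0 -> dt u v != 0 ->
  boost w (k *: u) (l *: v) = boost w u v.
Proof.
move=> w0 k0 l0 uv; have kluv : dt (k *: u) (l *: v) != 0.
  by rewrite dtZl dtZr !mulf_neq0.
apply: boost_unique => //.
  apply: (scalerI k0); rewrite scalemxAr (boost_fst w (k *: u) (l *: v)) !scalerA.
  by rewrite mulrC.
apply: (scalerI l0); rewrite scalemxAr (boost_snd w0 kluv) !scalerA.
by rewrite mulrC.
Qed.

(** A boost is characterized by its eigenvectors, which [A] transports. This exchanges right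
    multiplication of a frame by B_ij for left multiplication by a matrix built from the spinors of
    G. *)
Lemma boost_conj w A u v : w != 0 -> dt u v != 0 -> \det A != 0 ->
  boost w (A *m u) (A *m v) *m A = A *m boost w u v.
Proof.
move=> w0 uv dA; have Auv : dt (A *m u) (A *m v) != 0 by rewrite dt_mul mulf_neq0.
apply: (spinor_basis_eq uv).
  rewrite -[LHS]mulmxA (boost_fst w (A *m u)) -[RHS]mulmxA (boost_fst w u).
  by rewrite scalemxAr.
rewrite -[LHS]mulmxA (boost_snd w0 Auv) -[RHS]mulmxA (boost_snd w0 uv).
by rewrite scalemxAr.
Qed.

Lemma boost_inv w u v : w != 0 -> dt u v != 0 ->
  boost w v u *m boost w u v = 1%:M.
Proof.
move=> w0 uv; have vu : dt v u != 0 by rewrite dtC oppr_eq0.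
apply: (spinor_basis_eq uv); rewrite -[LHS]mulmxA mul1mx.
  by rewrite (boost_fst w u) -scalemxAr (boost_snd w0 vu) scalerA (mulVf w0) scale1r.
by rewrite (boost_snd w0 uv) -scalemxAr (boost_fst w v) scalerA (mulfV w0) scale1r.
Qed.

Lemma det_boost w u v : w != 0 -> dt u v != 0 -> \det (boost w u v) = 1.
Proof.
move=> w0 uv; apply: (mulIf uv); rewrite -dt_mul (boost_fst w u) (boost_snd w0 uv) dtZl dtZr.
by rewrite mul1r mulrA mulVf ?mul1r.
Qed.

(* Up to the common factor [1 / (w1 w2)], both sides are affine in the spinor
   projections, because a projection along [b] kills the one onto [b]. *)
Lemma boost_flat w1 w2 a b c d : w1 != 0 -> w2 != 0 ->
  dt a b != 0 -> dt b c != 0 -> dt c d != 0 -> dt d a != 0 ->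
  (1 - w2 ^+ 2) * (dt a b * dt c d) = (1 - w1 ^+ 2) * (dt b c * dt d a) ->
  boost w2 b c *m boost w1 a b = boost w1 d c *m boost w2 a d.
Proof.
move=> w10 w20 ab bc cd da cr.
have projM u v t : spinor_proj v t *m spinor_proj u v = 0.
  by apply: mx2_eqP; rewrite [RHS]mxE mulmx2E !(spinor_projE _ _ _).1
   !(spinor_projE _ _ _).2; ring.
have boostM k l u v t : boost l v t *m boost k u v = (l^-1 * k^-1) *: (1%:M -
    (1 - k ^+ 2) *: spinor_proj u v - (1 - l ^+ 2) *: spinor_proj v t).
  rewrite -scalemxAl -scalemxAr scalerA; congr (_ *: _).
  rewrite mulmxBl mul1mx -scalemxAl mulmxBr mulmx1 -scalemxAr projM scaler0 subr0.
  by rewrite addrAC.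
rewrite !boostM (mulrC w1^-1); congr (_ *: _).
rewrite -!addrA; congr (_ + _); rewrite -!opprD; congr (- _).
(* The common factor in the cross-ratio hypothesis. Through it every coefficient contains the
   denominator of its own projection, and the claim becomes a polynomial identity. *)
set q := (1 - w1 ^+ 2) / (dt a b * dt c d).
have e1 : 1 - w1 ^+ 2 = q * (dt a b * dt c d) by rewrite divfK // mulf_neq0.
have e2 : 1 - w2 ^+ 2 = q * (dt b c * dt d a).
  apply: (@mulIf _ (dt a b * dt c d)); first by rewrite mulf_neq0.
  by rewrite cr e1; ring.
have dc : dt d c != 0 by rewrite dtC oppr_eq0.
have ad : dt a d != 0 by rewrite dtC oppr_eq0.
have pE u v t p : dt u v != 0 -> ((t * dt u v) *: spinor_proj u v) p 0 =
    - (t * (v p 0 * u 1 0)) /\ ((t * dt u v) *: spinor_proj u v) p 1 =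
    t * (v p 0 * u 0 0).
  by move=> uv; have [f0 f1] := spinor_projE u v p; split; rewrite mxE ?f0 ?f1; field.
have -> : (1 - w1 ^+ 2) *: spinor_proj a b = (q * dt c d * dt a b) *: spinor_proj a b.
  by rewrite e1; congr (_ *: _); ring.
have -> : (1 - w2 ^+ 2) *: spinor_proj b c = (q * dt d a * dt b c) *: spinor_proj b c.
  by rewrite e2; congr (_ *: _); ring.
have -> : (1 - w1 ^+ 2) *: spinor_proj d c = (- q * dt a b * dt d c) *: spinor_proj d c.
  by rewrite e1 (dtC c d); congr (_ *: _); ring.
have -> : (1 - w2 ^+ 2) *: spinor_proj a d = (- q * dt b c * dt a d) *: spinor_proj a d.
  by rewrite e2 (dtC d a); congr (_ *: _); ring.
by apply: mx2_eqP; rewrite [LHS]mxE [RHS]mxE ?(pE _ _ _ _ ab).1 ?(pE _ _ _ _ bc).1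
  ?(pE _ _ _ _ dc).1 ?(pE _ _ _ _ ad).1 ?(pE _ _ _ _ ab).2 ?(pE _ _ _ _ bc).2
  ?(pE _ _ _ _ dc).2 ?(pE _ _ _ _ ad).2 /dt; ring.
Qed.

Definition outer u v : 'M[C]_2 := mx2 (u 0 0 * v 0 0) (u 0 0 * v 1 0)
  (u 1 0 * v 0 0) (u 1 0 * v 1 0).

Lemma outer_mul A B u v : outer (A *m u) (B *m v) = A *m outer u v *m B^T.
Proof. by apply: mx2_eqP; rewrite !(mx2_entries, mulmx2E, mxE); ring. Qed.

Lemma outerZ (k l : C) u v : outer (k *: u) (l *: v) = (k * l) *: outer u v.
Proof. by apply: mx2_eqP; rewrite [RHS]mxE !mx2_entries !mxE; ring. Qed.

Lemma bil_congruence T U A B :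
  bil (T *m A *m U^T) (T *m B *m U^T) = \det T * \det U * bil A B.
Proof. by rewrite /bil !det_mx2E !(mulmx2E, mxE); ring. Qed.

Lemma bil_outer u v a b : bil (outer u v) (outer a b) = dt u a * dt v b.
Proof. by rewrite /bil /dt !mx2_entries; ring. Qed.

(** The congruence X -> T X T^* with conjugation removed: [a], [b] and [sg * w] stand for the
    conjugates of [u], [v] and [w], which leaves a rational identity over an arbitrary field. *)
Lemma boost_congruence (w sg : C) u v a b A : w != 0 -> sg ^+ 2 = 1 ->
  dt u v != 0 -> dt a b != 0 ->
  boost w u v *m A *m (boost (sg * w) a b)^T = sg *: (A +
    ((1 - w ^+ 2) / w ^+ 2 * bil A (outer v b) / (dt u v * dt a b)) *: outer u a -
    ((1 - w ^+ 2) * bil A (outer u a) / (dt u v * dt a b)) *: outer v b).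
Proof.
move=> w0 sg2 uv ab.
have sgV : sg^-1 = sg.
  have sg0 : sg != 0 by apply: contra_eq_neq sg2 => ->; rewrite expr0n eq_sym oner_eq0.
  by apply: (mulfI sg0); rewrite mulfV // -expr2.
have trZ (k : C) (X : 'M[C]_2) : (k *: X)^T = k *: X^T.
  by apply/matrixP=> p q; rewrite !mxE.
rewrite /boost exprMn sg2 mul1r invfM sgV trZ -!scalemxAl -scalemxAr scalerA.
rewrite mulrCA -[LHS]scalerA; congr (_ *: _).
set t := w ^+ 2; have t0 : t != 0 by rewrite expf_neq0.
have -> : w^-1 * w^-1 = t^-1 by rewrite -invfM -expr2.
apply: (scalerI t0); rewrite scalerA divff // scale1r.
have [p00 p01] := spinor_projE u v 0; have [p10 p11] := spinor_projE u v 1.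
have [q00 q01] := spinor_projE a b 0; have [q10 q11] := spinor_projE a b 1.
have bE p q : (1%:M - (1 - t) *: spinor_proj u v : 'M_2) p q =
  (p == q)%:R - (1 - t) * spinor_proj u v p q by rewrite !mxE.
have cE p q : ((1%:M - (1 - t) *: spinor_proj a b)^T : 'M_2) p q =
  (q == p)%:R - (1 - t) * spinor_proj a b q p by rewrite !mxE.
have rE p q (x y : C) (X Y : 'M[C]_2) : (t *: (A + x *: X - y *: Y)) p q =
  t * (A p q + x * X p q - y * Y p q) by rewrite !mxE.
by apply: mx2_eqP; rewrite rE !mulmx2E !bE !cE ?p00 ?p01 ?p10 ?p11 ?q00 ?q01 ?q10 ?q11 /=
  /bil !mx2_entries; move: uv ab; rewrite /dt => uv ab; field; rewrite uv ab t0.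
Qed.

End SpinorAlgebra.

Lemma dt_map (F K : fieldType) (f : {rmorphism F -> K}) (u v : 'cV[F]_2) :
  dt (map_mx f u) (map_mx f v) = f (dt u v).
Proof. by rewrite /dt !mxE rmorphB !rmorphM. Qed.

Lemma map_boost (F K : fieldType) (f : {rmorphism F -> K}) w (u v : 'cV[F]_2) :
  map_mx f (boost w u v) = boost (f w) (map_mx f u) (map_mx f v).
Proof.
rewrite /boost /spinor_proj [dt (map_mx _ _) _]dt_map map_mxZ map_mxB map_mx1 !map_mxZ.
have -> : f (1 - w ^+ 2) = 1 - f w ^+ 2 by rewrite rmorphB rmorph1 rmorphXn.
have -> : f w^-1 = (f w)^-1 by exact: fmorphV.
have -> : f (dt u v)^-1 = (f (dt u v))^-1 by exact: fmorphV.
congr (_ *: (_ - _ *: (_ *: _))).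
apply: mx2_eqP; rewrite mxE !mx2_entries !mxE.
- by rewrite rmorphN rmorphM.
- by rewrite rmorphM.
- by rewrite rmorphN rmorphM.
- by rewrite rmorphM.
Qed.


(** * Minkowski vectors as Hermitian matrices, null vectors as spinors *)

Section Spinors.

Variable R : realType.
Notation C := R[i].
Implicit Types (u v a b c d : 'cV[C]_2) (x y g : mink R) (A B T : 'M[C]_2).

Lemma adjointE A p q : adjoint A p q = Num.conj (A q p).
Proof. by rewrite !mxE. Qed.

Lemma adjointM A B : adjoint (A *m B) = adjoint B *m adjoint A.
Proof. by apply: mx2_eqP; rewrite !(adjointE, mulmx2E); ring. Qed.

Lemma hermD x y : herm (x + y) = herm x + herm y.
Proof.
apply: mx2_eqP; rewrite !mxE /=; apply/eqP;
  rewrite eq_complex /= ?addr0 ?eqxx ?andbT //; apply/eqP; ring.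
Qed.

Lemma hermZ (k : R) x : herm (k *: x) = k%:C *: herm x.
Proof.
apply: mx2_eqP; rewrite !mxE /=; apply/eqP; rewrite eq_complex /=;
  apply/andP; split; apply/eqP; ring.
Qed.

Lemma hermN x : herm (- x) = - herm x.
Proof. by rewrite -scaleN1r hermZ rmorphN1 scaleN1r. Qed.

Lemma herm_inj : injective (@herm R).
Proof.
move=> x y e.
have := congr1 (fun A : 'M_2 => A 0 0) e; rewrite !mx2_entries => /complexI e0.
have := congr1 (fun A : 'M_2 => A 1 1) e; rewrite !mx2_entries => /complexI e1.
have := congr1 (fun A : 'M_2 => A 0 1) e; rewrite !mx2_entries => -[e2 e3].
by apply: mink_eqP => //; lra.
Qed.

(** Polarization of (v,v) = -det. *)
Lemma mprod_bil x y : (mprod x y)%:C = - 2%:R^-1 * bil (herm x) (herm y).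
Proof.
have cE (p q : R) : p +i* q = p%:C + 'i * q%:C.
  by apply/eqP; rewrite eq_complex /=; apply/andP; split; apply/eqP; ring.
rewrite /bil !mx2_entries mprodE !cE.
have i2 : 'i * 'i = -1 :> C by rewrite -expr2 sqr_i.
transitivity (- ((x 0 0)%:C * (y 0 0)%:C) + (x 0 1)%:C * (y 0 1)%:C
  - ('i * 'i) * (x 0 2%:R)%:C * (y 0 2%:R)%:C + (x 0 3%:R)%:C * (y 0 3%:R)%:C).
  by rewrite i2; ring.
by field.
Qed.

(** The rank one Hermitian matrix [u u^*], written with [outer] so that the identities for [bil]
    apply to it. *)
Definition spinor_mx u : 'M[C]_2 := outer u (map_mx Num.conj u).

Lemma adjoint_tr A : adjoint A = (map_mx Num.conj A)^T.
Proof. by apply/matrixP=> p q; rewrite !mxE. Qed.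

Lemma spinor_mx_mul A u : spinor_mx (A *m u) = A *m spinor_mx u *m adjoint A.
Proof. by rewrite /spinor_mx map_mxM outer_mul -adjoint_tr. Qed.

Lemma spinor_mxZ (k : C) u : spinor_mx (k *: u) = (k * Num.conj k) *: spinor_mx u.
Proof. by rewrite /spinor_mx map_mxZ outerZ. Qed.

Lemma bil_adjoint T A B : bil (T *m A *m adjoint T) (T *m B *m adjoint T) =
  \det T * Num.conj (\det T) * bil A B.
Proof. by rewrite adjoint_tr bil_congruence det_map_mx. Qed.

Lemma bil_spinor_mx u v : bil (spinor_mx u) (spinor_mx v) = dt u v * Num.conj (dt u v).
Proof. by rewrite bil_outer; congr (_ * _); exact: dt_map. Qed.

Lemma mprod_spinors x y u v : herm x = spinor_mx u -> herm y = spinor_mx v ->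
  (mprod x y)%:C = - 2%:R^-1 * (dt u v * Num.conj (dt u v)).
Proof.
by move=> xE yE; rewrite mprod_bil xE yE bil_spinor_mx.
Qed.

Lemma mprod_spinor_null x u : herm x = spinor_mx u -> mprod x x = 0.
Proof.
move=> xE; apply: complexI; rewrite (mprod_spinors xE xE).
by rewrite dtxx !(mul0r, mulr0).
Qed.

Lemma mul_conj_eq0 (z : C) : (z * Num.conj z == 0) = (z == 0).
Proof. by rewrite mulf_eq0 fmorph_eq0 orbb. Qed.

Lemma mprod_spinors_neq0 x y u v : herm x = spinor_mx u -> herm y = spinor_mx v ->
  (mprod x y != 0) = (dt u v != 0).
Proof.
move=> xE yE; apply/idP/idP; apply: contra_neq => e.
  by apply: complexI; rewrite (mprod_spinors xE yE) e mul0r mulr0.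
have := mprod_spinors xE yE; rewrite e => /esym/eqP.
by rewrite mulf_eq0 oppr_eq0 invr_eq0 pnatr_eq0 /= mul_conj_eq0 => /eqP.
Qed.

(** Although w may be imaginary, only w^2 = t and conj w = sg w enter, so the action on Minkowski
    vectors is real: a translation within the plane of [g] and [h], followed by the sign [sg]. *)
Lemma boost_herm (w : C) (t sg : R) u v x g h :
  w != 0 -> dt u v != 0 -> w ^+ 2 = t%:C -> Num.conj w = sg%:C * w -> sg ^+ 2 = 1 ->
  herm g = spinor_mx u -> herm h = spinor_mx v ->
  boost w u v *m herm x *m adjoint (boost w u v) = sg%:C *: herm (x +
    ((1 - t) / t * mprod x h / mprod g h) *: g - ((1 - t) * mprod x g / mprod g h) *: h).
Proof.
move=> w0 uv wt wc sg2 gE hE.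
have gh : (mprod g h)%:C = - 2%:R^-1 * (dt u v * Num.conj (dt u v)).
  exact: mprod_spinors.
have uvc : Num.conj (dt u v) != 0 by rewrite fmorph_eq0.
have dtc : dt (map_mx Num.conj u) (map_mx Num.conj v) = Num.conj (dt u v) := dt_map _ u v.
have -> : adjoint (boost w u v) =
    (boost (sg%:C * w) (map_mx Num.conj u) (map_mx Num.conj v))^T.
  by rewrite adjoint_tr -wc; congr (_^T); exact: map_boost.
have sgC : sg%:C ^+ 2 = 1 :> C by rewrite -rmorphXn sg2 rmorph1.
have uvc' : dt (map_mx Num.conj u) (map_mx Num.conj v) != 0 by rewrite dtc.
rewrite (boost_congruence _ w0 sgC uv uvc').
have real1 : ((1 - t) / t * mprod x h / mprod g h)%:C =
   (1 - w ^+ 2) / w ^+ 2 * bil (herm x) (spinor_mx v) / (dt u v * Num.conj (dt u v)).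
  rewrite !(rmorphM, fmorphV) rmorphB rmorph1 /= -wt gh mprod_bil hE.
  move: (bil _ _) => z; field.
  by rewrite uv uvc w0.
have real2 : ((1 - t) * mprod x g / mprod g h)%:C =
   (1 - w ^+ 2) * bil (herm x) (spinor_mx u) / (dt u v * Num.conj (dt u v)).
  rewrite !(rmorphM, fmorphV) rmorphB rmorph1 /= -wt gh mprod_bil gE.
  move: (bil _ _) => z; field.
  by rewrite uv uvc.
by rewrite !hermD hermN !hermZ gE hE real1 real2 dtc.
Qed.

End Spinors.

(** * Cross-ratios, integration on the lattice, normal forms *)

Section Auxiliary.

Variable R : realType.
Notation C := R[i].

Lemma conj_real (x : R) : Num.conj x%:C = x%:C :> C.
Proof. exact: conjc_real. Qed.

(** At z = [dt u v] this is the Minkowski product of the null vectors with spinors [u] and [v]. *)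
Let N (z : C) := - 2%:R^-1 * (z * Num.conj z).

(** Multiply the cross-ratio equation by its conjugate. By the Plücker relation it also reads s2 ac
    bd = (s1 - s2) bc da, which gives the second identity in the same way. *)
Lemma cross_ratio_norms (s1 s2 : R) (ab cd bc da ac bd : C) :
  ac * bd = ab * cd - bc * da -> s2%:C * (ab * cd) = s1%:C * (bc * da) ->
  N ab * N cd * s2%:C ^+ 2 = N da * N bc * s1%:C ^+ 2 /\
  N ac * N bd * s2%:C ^+ 2 = N da * N bc * (s1%:C - s2%:C) ^+ 2.
Proof.
move=> pl cr; have := congr1 Num.conj cr; have := congr1 Num.conj pl.
rewrite !rmorphM rmorphB !rmorphM /= !conj_real => plc crc; rewrite /N; split.
  transitivity (4%:R^-1 * ((s2%:C * (ab * cd)) *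
    (s2%:C * (Num.conj ab * Num.conj cd)))); first by field.
  by rewrite cr crc; field.
transitivity (4%:R^-1 * ((s2%:C * (ac * bd)) *
    (s2%:C * (Num.conj ac * Num.conj bd)))); first by field.
by rewrite pl plc !(mulrBr s2%:C) cr crc; field.
Qed.

(** Put z = (ab cd)/(bc da) and q = s1/s2. From |z|^2 = q^2 and |z - 1|^2 = (q - 1)^2 follows Re z =
    q (this is [G3]), hence |z - q|^2 = 0. The proof clears all denominators. *)
Lemma cross_ratio_of_norms (s1 s2 : R) (ab cd bc da ac bd : C) : s2 != 0 ->
  ac * bd = ab * cd - bc * da ->
  N ab * N cd * s2%:C ^+ 2 = N da * N bc * s1%:C ^+ 2 ->
  N ac * N bd * s2%:C ^+ 2 = N da * N bc * (s1%:C - s2%:C) ^+ 2 ->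
  s2%:C * (ab * cd) = s1%:C * (bc * da).
Proof.
move=> s20 pl g1 g2; have := congr1 Num.conj pl.
rewrite rmorphB !rmorphM /= => plc.
set X := ab * cd in pl *; set Z := bc * da in pl *.
set X' := Num.conj ab * _ in plc; set Z' := Num.conj bc * _ in plc.
have G1 : s2%:C ^+ 2 * (X * X') = s1%:C ^+ 2 * (Z * Z').
  transitivity (4%:R * (N ab * N cd * s2%:C ^+ 2)).
    by rewrite /N /X /X'; field.
  by rewrite g1 /N /Z /Z'; field.
have G2 : s2%:C ^+ 2 * ((X - Z) * (X' - Z')) = (s1%:C - s2%:C) ^+ 2 * (Z * Z').
  rewrite -pl -plc; transitivity (4%:R * (N ac * N bd * s2%:C ^+ 2)).
    by rewrite /N; field.
  by rewrite g2 /N /Z /Z'; field.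
have s2C : s2%:C != 0 :> C by rewrite fmorph_eq0.
have G3 : s2%:C * (X * Z' + Z * X') = 2%:R * s1%:C * (Z * Z').
  apply: (mulfI s2C).
  transitivity (s2%:C ^+ 2 * (X * X') + s2%:C ^+ 2 * (Z * Z') -
    s2%:C ^+ 2 * ((X - Z) * (X' - Z'))); first by ring.
  by rewrite G1 G2; ring.
apply/eqP; rewrite -subr_eq0 -mul_conj_eq0 rmorphB !rmorphM /= !conj_real.
apply/eqP; transitivity (s2%:C ^+ 2 * (X * X') - s1%:C * (s2%:C * (X * Z' + Z * X')) +
   s1%:C ^+ 2 * (Z * Z')); first by rewrite /X /Z /X' /Z'; ring.
by rewrite G1 G3; ring.
Qed.

Lemma mprod_spinorsN (x y : mink R) u v : herm x = spinor_mx u ->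
  herm y = spinor_mx v -> (mprod x y)%:C = N (dt u v).
Proof. exact: mprod_spinors. Qed.

Lemma gram_complexE (s2 p q r s t : R) :
  (p * q * s2 ^+ 2 = r * s * t ^+ 2) <->
  (p%:C * q%:C * s2%:C ^+ 2 = r%:C * s%:C * t%:C ^+ 2).
Proof.
split=> [/(congr1 (real_complex R))|e]; first by rewrite !(rmorphM, rmorphXn).
by apply: complexI; rewrite !(rmorphM, rmorphXn).
Qed.

Lemma gram_cross_ratio (s1 s2 : R) (a b c d : 'cV[C]_2) (ga gb gc gd : mink R) :
  herm ga = spinor_mx a -> herm gb = spinor_mx b ->
  herm gc = spinor_mx c -> herm gd = spinor_mx d -> s2 != 0 ->
  s2%:C * (dt a b * dt c d) = s1%:C * (dt b c * dt d a) <->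
  mprod ga gb * mprod gc gd * s2 ^+ 2 = mprod ga gd * mprod gb gc * s1 ^+ 2 /\
  mprod ga gc * mprod gb gd * s2 ^+ 2 =
    mprod ga gd * mprod gb gc * (s1 - s2) ^+ 2.
Proof.
move=> aE bE cE dE s20; have pl := dt_plucker a b c d.
rewrite !gram_complexE // rmorphB /= (mprodC ga gd) (mprod_spinorsN aE bE)
  (mprod_spinorsN cE dE) (mprod_spinorsN dE aE) (mprod_spinorsN bE cE)
  (mprod_spinorsN aE cE) (mprod_spinorsN bE dE).
split; first exact: cross_ratio_norms.
by case=> g1 g2; apply: cross_ratio_of_norms pl g1 g2.
Qed.

(** * Integration of flat transition maps on the lattice *)

Lemma edgeC (i j : Z2) : edge i j = edge j i.
Proof. by rewrite /edge !(distrC j.1, distrC j.2). Qed.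

Lemma edgeP (i j : Z2) : edge i j ->
  [\/ j = (i.1 + 1, i.2), j = (i.1 - 1, i.2), j = (i.1, i.2 + 1) |
      j = (i.1, i.2 - 1)].
Proof.
case: i j => [i1 i2] [j1 j2]; rewrite /edge /= => e.
have : (j1 = i1 + 1 /\ j2 = i2) \/ (j1 = i1 - 1 /\ j2 = i2) \/
  (j1 = i1 /\ j2 = i2 + 1) \/ (j1 = i1 /\ j2 = i2 - 1) by lia.
by case=> [[-> ->]|[[-> ->]|[[-> ->]|[-> ->]]]];
  [constructor 1|constructor 2|constructor 3|constructor 4].
Qed.

Fixpoint nat_orbit (A : Type) (T : nat -> A -> A) (a0 : A) (n : nat) : A :=
  if n is n'.+1 then T n' (nat_orbit T a0 n') else a0.

(** [T n] leads from position n to n + 1 and [T' n] back from n + 1 to n. As [Negz n] is -(n + 1),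
    it takes [n.+1] backward steps. *)
Definition int_orbit (A : Type) (T T' : int -> A -> A) (a0 : A) (n : int) : A :=
  match n with
  | Posz n => nat_orbit (fun p => T p%:Z) a0 n
  | Negz n => nat_orbit (fun p => T' (- p.+1%:Z)) a0 n.+1
  end.

Lemma int_orbitS (A : Type) (T T' : int -> A -> A) a0 n :
  (forall n a, T n (T' n a) = a) ->
  int_orbit T T' a0 (n + 1) = T n (int_orbit T T' a0 n).
Proof.
move=> TT'; case: n => n.
  by rewrite addrC -intS.
have -> : Negz n + 1 = - (Posz n) by rewrite NegzE intS opprD addrAC addNr add0r.
rewrite /= -NegzE TT'; case: n => [//|n].
by rewrite -NegzE.
Qed.

(** Integrate along the horizontal axis ([U]), then along each vertical line ([V]). The horizontal
    rule then holds on the axis, and flatness of the faces carries it from row to row ([HS]). *)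
Lemma Z2_integrable (A : Type) (S : Z2 -> Z2 -> A -> A) (a0 : A) :
  (forall i j a, edge i j -> S j i (S i j a) = a) ->
  (forall i j k l a, face i j k l -> S j k (S i j a) = S l k (S i l a)) ->
  exists f : Z2 -> A, f (0, 0) = a0 /\ forall i j, edge i j -> f j = S i j (f i).
Proof.
move=> inv flat.
pose E (x y : int) : Z2 := (x, y).
have eh x y : edge (E x y) (E (x + 1) y).
  by rewrite /edge /= opprD addrA subrr sub0r normrN1 subrr normr0 addr0.
have ev x y : edge (E x y) (E x (y + 1)).
  by rewrite /edge /= subrr normr0 add0r opprD addrA subrr sub0r normrN1.
pose U := int_orbit (fun n => S (E n 0) (E (n + 1) 0)) (fun n => S (E (n + 1) 0) (E n 0)) a0.
pose V x := int_orbit (fun n => S (E x n) (E x (n + 1)))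
  (fun n => S (E x (n + 1)) (E x n)) (U x).
have VS x n : V x (n + 1) = S (E x n) (E x (n + 1)) (V x n).
  by apply: int_orbitS => m a; apply: inv; rewrite edgeC.
have US n : U (n + 1) = S (E n 0) (E (n + 1) 0) (U n).
  by apply: int_orbitS => m a; apply: inv; rewrite edgeC.
have fc x y : face (E x y) (E (x + 1) y) (E (x + 1) (y + 1)) (E x (y + 1)).
  rewrite /face eh ev (edgeC _ (E x (y + 1))) eh (edgeC _ (E x y)) ev /=.
  by apply/andP; split; apply/eqP => -[]; lia.
have HS n : forall x, V (x + 1) n = S (E x n) (E (x + 1) n) (V x n).
  elim/int_rect: n => [|n IH|n IH] x; first exact: US.
    by rewrite -addn1 PoszD !VS IH (flat _ _ _ _ _ (fc x n)).
  have -> : - Posz n.+1 = - Posz n - 1 by rewrite intS opprD addrC.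
  move: (- Posz n) IH => m IH; set p := m - 1.
  have mE : m = p + 1 by rewrite /p subrK.
  rewrite mE in IH; move: (IH x); rewrite !VS -(flat _ _ _ _ _ (fc x p)).
  by move=> /(congr1 (S (E (x + 1) (p + 1)) (E (x + 1) p))); rewrite !inv.
exists (fun i => V i.1 i.2); split=> // i j /edgeP.
case: i => x y /=; case=> -> /=.
- exact: HS.
- by have := HS y (x - 1); have := eh (x - 1) y; rewrite subrK => h ->; rewrite inv.
- exact: VS.
- by have := VS x (y - 1); have := ev x (y - 1); rewrite subrK => h ->; rewrite inv.
Qed.

(** Cantor's nested intervals: step n keeps the outer quarter of the current interval on the side of
    the midpoint away from [f n]. The supremum of the left ends lies in all intervals. *)
Lemma exists_avoiding (f : nat -> R) (e : R) : 0 < e ->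
  exists y, [/\ 0 < y, y < e & forall n, y != f n].
Proof.
move=> e0.
pose shrink (I : R * R) (z : R) : R * R :=
  if z <= (I.1 + I.2) / 2%:R then ((I.1 + 3%:R * I.2) / 4%:R, I.2)
  else (I.1, (3%:R * I.1 + I.2) / 4%:R).
pose I := nat_orbit (fun n J => shrink J (f n)) (e / 3%:R, e / 2%:R).
have IS n : [/\ (I n).1 <= (I n.+1).1, (I n.+1).1 < (I n.+1).2,
    (I n.+1).2 <= (I n).2 & (f n < (I n.+1).1) || ((I n.+1).2 < f n)].
  have lt_I : (I n).1 < (I n).2.
    elim: n => [|n IH]; first by rewrite /I /=; lra.
    by rewrite /I /= -/(I n) /shrink; case: ifP => _ /=; lra.
  rewrite /I /= -/(I n) /shrink; case: ifP => h /=.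
    by split; [lra|lra|lra|apply/orP; left; lra].
  move/negbT: h; rewrite -ltNge => h.
  by split; [lra|lra|lra|apply/orP; right; lra].
have mono1 n m : (n <= m)%N -> (I n).1 <= (I m).1.
  move=> /subnK <-; elim: (m - n)%N => [|k IH] //.
  by have [h _ _ _] := IS (k + n)%N; apply: le_trans h.
have mono2 n m : (n <= m)%N -> (I m).2 <= (I n).2.
  move=> /subnK <-; elim: (m - n)%N => [|k IH] //.
  by have [_ _ h _] := IS (k + n)%N; apply: le_trans h _.
have lt12 n : (I n).1 < (I n).2.
  by case: n => [|n]; [rewrite /I /=; lra | have [] := IS n].
have ub n m : (I m).1 <= (I n).2.
  case: (leqP n m) => h.
    exact: le_trans (ltW (lt12 m)) (mono2 _ _ h).
  exact: le_trans (mono1 _ _ (ltnW h)) (ltW (lt12 n)).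
pose A : set R := [set x | exists n, x = (I n).1]%classic.
have A0 : (A !=set0)%classic by exists (I 0).1, 0.
have Aub n : ubound A (I n).2 by move=> x [m ->].
have le1 n : (I n).1 <= sup A.
  by apply: ub_le_sup; [exists (I 0).2; apply: Aub | exists n].
have le2 n : sup A <= (I n).2 by apply: ge_sup.
exists (sup A); split.
- by apply: lt_le_trans (le1 0%N); rewrite /I /=; lra.
- by apply: le_lt_trans (le2 0%N) _; rewrite /I /=; lra.
move=> n; have [_ _ _] := IS n; apply: contraTneq => <-.
by rewrite negb_or -!leNgt le1 le2.
Qed.

(** * Normal form of Hermitian matrices of determinant -mu *)

Definition congruent (mu : R) (H : 'M[C]_2) := exists2 A : 'M[C]_2,
  \det A = 1 & H = A *m mx2 1 0 0 (- mu%:C) *m adjoint A.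

Lemma congruent_mul mu (B H : 'M[C]_2) : \det B = 1 ->
  congruent mu (B *m H *m adjoint B) -> congruent mu H.
Proof.
move=> dB [A dA e].
have uB : B \in unitmx by rewrite unitmxE dB unitr1.
have aB : adjoint (invmx B) = invmx (adjoint B).
  by rewrite !adjoint_tr -trmx_inv; congr (_^T); exact: map_invmx.
exists (invmx B *m A); first by rewrite det_mulmx det_inv dB dA invr1 mulr1.
have -> : invmx B *m A *m mx2 1 0 0 (- mu%:C) *m adjoint (invmx B *m A) =
    invmx B *m (A *m mx2 1 0 0 (- mu%:C) *m adjoint A) *m adjoint (invmx B).
  by rewrite adjointM !mulmxA.
have uaB : adjoint B \in unitmx by rewrite adjoint_tr unitmx_tr map_unitmx.
by rewrite -e aB !mulmxA mulVmx // mul1mx mulmxK.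
Qed.

Definition hmx (p q : R) (z : C) : 'M[C]_2 := mx2 p%:C z (Num.conj z) q%:C.

(** A Cholesky factor with diagonal sqrt p, 1 / sqrt p. The hypothesis says that the determinant is
    -mu, which fixes the lower right entry. *)
Lemma congruent_pos mu (p q : R) (z : C) : 0 < p ->
  z * Num.conj z = mu%:C + p%:C * q%:C -> congruent mu (hmx p q z).
Proof.
move=> p0 zz; set s := Num.sqrt p.
have s0 : s%:C != 0 :> C by rewrite fmorph_eq0 sqrtr_eq0 -ltNge.
have ss : s%:C ^+ 2 = p%:C :> C by rewrite -rmorphXn sqr_sqrtr // ltW.
exists (mx2 s%:C 0 (Num.conj z / s%:C) s%:C^-1).
  by rewrite det_mx2E !mx2_entries mul0r subr0 mulfV.
have sc : Num.conj s%:C = s%:C :> C := conj_real s.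
have q0 : q%:C = (z * Num.conj z - mu%:C) / s%:C ^+ 2 :> C.
  by rewrite zz ss addrC addKr mulrC mulKf // -ss expf_neq0.
by apply: mx2_eqP; rewrite !mulmx2E !adjointE !mx2_entries
  ?(rmorphM, fmorphV, rmorph0) /= ?sc ?conjCK ?q0 -?ss; field.
Qed.

Definition congruent_up_to_sign (mu : R) (H : 'M[C]_2) := exists e : R,
  [/\ e = 1 \/ e = -1, 0 < mu -> e = 1 & congruent mu (e%:C *: H)].

Lemma congruent_up_to_sign_mul mu (B H : 'M[C]_2) : \det B = 1 ->
  congruent_up_to_sign mu (B *m H *m adjoint B) -> congruent_up_to_sign mu H.
Proof.
move=> dB [e [he mue h]]; exists e; split=> //; apply: (congruent_mul dB).
by rewrite -scalemxAr -scalemxAl.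
Qed.

(** Everything is reduced to a positive upper left entry. If p < 0, negate when mu <= 0; when mu >
    0, diagonalize and exchange the diagonal entries, so that -mu/p > 0 comes first. If p = 0 and q
    != 0, exchange them. If both vanish, then |z|^2 = mu > 0 and a shear produces the entry 2 mu. *)
Lemma congruent_up_to_sign_hmx mu (p q : R) (z : C) :
  z * Num.conj z = mu%:C + p%:C * q%:C -> hmx p q z != 0 ->
  congruent_up_to_sign mu (hmx p q z).
Proof.
have pos p' q' z' : z' * Num.conj z' = mu%:C + p'%:C * q'%:C ->
    0 < p' -> congruent_up_to_sign mu (hmx p' q' z').
  by move=> zz p0; exists 1; split; [left|by []|rewrite scale1r; apply: congruent_pos].
have neq p' q' z' : z' * Num.conj z' = mu%:C + p'%:C * q'%:C ->
    p' != 0 -> congruent_up_to_sign mu (hmx p' q' z').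
  move=> zz p0; have [pp|pn|p00] := ltrgtP p' 0; last by rewrite p00 eqxx in p0.
    have [mu0|mu0] := leP mu 0.
      exists (-1); split; [by right|by rewrite ltNge mu0|].
      have -> : (-1)%:C *: hmx p' q' z' = hmx (- p') (- q') (- z').
        apply: mx2_eqP; rewrite mxE !mx2_entries rmorphN1 mulN1r ?rmorphN //.
      apply: congruent_pos; first by rewrite oppr_gt0.
      by rewrite !rmorphN /= !mulrNN.
    have pC : p'%:C != 0 :> C by rewrite fmorph_eq0.
    pose A := mx2 (- Num.conj z' / p'%:C) 1 (-1) 0 : 'M[C]_2.
    have dA : \det A = 1 by rewrite det_mx2E !mx2_entries mulr0 mulrN1 sub0r opprK.
    apply: (congruent_up_to_sign_mul dA).
    have -> : A *m hmx p' q' z' *m adjoint A = hmx (- (mu / p')) p' 0.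
      have pc : Num.conj p'%:C = p'%:C :> C := conj_real p'.
      have q0 : q'%:C = (z' * Num.conj z' - mu%:C) / p'%:C :> C.
        by rewrite zz addrC addKr mulrC mulKf.
      by apply: mx2_eqP; rewrite !mulmx2E !adjointE !mx2_entries
        ?(rmorphN, rmorphM, fmorphV, rmorph0, rmorph1) /= ?pc ?conjCK ?q0; field.
    apply: pos; last by rewrite oppr_gt0 pmulr_rlt0 // invr_lt0.
    by rewrite mul0r -rmorphM -rmorphD mulNr divfK // subrr rmorph0.
  exact: pos.
move=> zz h0; have [p0|p0] := eqVneq p 0; last exact: neq.
have [q0|q0] := eqVneq q 0; last first.
  pose S := mx2 0 1 (-1) 0 : 'M[C]_2.
  have dS : \det S = 1 by rewrite det_mx2E !mx2_entries mul0r mulrN1 sub0r opprK.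
  apply: (congruent_up_to_sign_mul dS).
  have -> : S *m hmx p q z *m adjoint S = hmx q p (- Num.conj z).
    by apply: mx2_eqP; rewrite !mulmx2E !adjointE !mx2_entries
      ?(rmorphN, rmorph0, rmorph1) /= ?conjCK; ring.
  by apply: neq => //; rewrite rmorphN /= conjCK mulrNN mulrC zz [q%:C * _]mulrC.
have z0 : z != 0.
  apply: contraNneq h0 => z0; rewrite p0 q0 z0.
  by apply/eqP/mx2_eqP; rewrite !mx2_entries mxE // rmorph0.
have muE : mu%:C = z * Num.conj z :> C by rewrite zz p0 mul0r addr0.
have mu0 : 0 < mu.
  rewrite -ltcR rmorph0 muE -normCK exprn_gt0 ?normr_gt0 //.
pose A := mx2 1 z 0 1 : 'M[C]_2.
have dA : \det A = 1 by rewrite det_mx2E !mx2_entries mulr0 mulr1 subr0.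
apply: (congruent_up_to_sign_mul dA).
have -> : A *m hmx p q z *m adjoint A = hmx (2%:R * mu) 0 z.
  apply: mx2_eqP; rewrite !mulmx2E !adjointE !mx2_entries p0 q0
      ?(rmorph0, rmorph1, rmorphM, rmorph_nat) /= ?muE; ring.
by apply: pos; [rewrite mulr0 addr0 -muE|rewrite mulr_gt0].
Qed.

End Auxiliary.

(** * Dual nets and linear Weingarten surfaces *)

Section DualNets.

Variable R : realType.
Implicit Types (x h y n g : Z2 -> mink R) (G : Z2 -> {vspace mink R}).

Lemma faceP (i j k l : Z2) : face i j k l ->
  [/\ edge i j, edge j k, edge k l & edge l i].
Proof. by case/and5P=> ? ? ? ? _. Qed.

(* [x] stands for the middle section x^M and [h i] for the generator of G_i with
   [(x i, h i) = 1]; the last two conditions say that G_i, G_j, G_k, G_l have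
   cross-ratio [s i j / s i l]. *)
Definition dual_net (mu : R) x h (s : Z2 -> Z2 -> R) : Prop :=
  [/\ forall i, [/\ mprod (h i) (h i) = 0, mprod (x i) (h i) = 1 &
        mprod (x i) (x i) = mu],
      forall i j, edge i j -> [/\ mprod (h i) (h j) != 0, s i j = s j i &
        x j - x i = (s i j / mprod (h i) (h j)) *: (h i - h j)] &
      forall i j k l, face i j k l ->
        [/\ s i j = s l k /\ s i l = s j k,
            [/\ s i j != 0, s i l != 0 & s i j != s i l],
            mprod (h i) (h j) * mprod (h k) (h l) * s i l ^+ 2 =
              mprod (h i) (h l) * mprod (h j) (h k) * s i j ^+ 2 &
            mprod (h i) (h k) * mprod (h j) (h l) * s i l ^+ 2 =
              mprod (h i) (h l) * mprod (h j) (h k) * (s i j - s i l) ^+ 2]].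

Lemma lift_scale g h G p : is_lift g G -> G p = <[h p]>%VS -> h p != 0 ->
  exists2 k : R, k != 0 & g p = k *: h p.
Proof.
move=> gl GE h0; have : g p \in <[h p]>%VS by rewrite -GE gl memv_line.
case/vlineP => k gk; exists k => //; apply: contraNneq h0 => k0.
have : h p \in <[g p]>%VS by rewrite -gl GE memv_line.
by rewrite gk k0 scale0r => /vlineP [? ->]; rewrite scaler0.
Qed.

(** The formula is homogeneous of degree 0 in the lift, so it may be evaluated at the normalized
    generator. The same holds for the Gauss map below. *)
Lemma middle_section_scale (mu s k : R) y g h p : k != 0 -> g p = k *: h p ->
  mprod (h p) (y p) = 1 ->
  middle_section mu s y g p = y p + ((mu + s) / 2%:R) *: h p.
Proof.
move=> k0 gk hy; rewrite /middle_section gk mprodZl hy mulr1 scalerA.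
by have -> : (mu + s) / (2%:R * k) * k = (mu + s) / 2%:R by field.
Qed.

Lemma gauss_map_scale (s k : R) y g h p : k != 0 -> g p = k *: h p ->
  mprod (h p) (y p) = 1 -> gauss_map s y g p = - s *: h p - y p.
Proof. by move=> k0 gk hy; rewrite /gauss_map gk mprodZl hy mulr1 scalerA mulNr divfK. Qed.

Section Net.

Variables (mu : R) (x h : Z2 -> mink R) (s : Z2 -> Z2 -> R).
Hypothesis net : dual_net mu x h s.

(** The routes from i to k through j and through l give the two expressions of the diagonal in
    [diagonal_parallel]. *)
Lemma dual_net_diagonal i j k l : face i j k l ->
  exists t, x k - x i = t *: (h j - h l).
Proof.
have [vert edges faces] := net; move=> f.
have [[e1 e2] [s1 s2 s12] g1 g2] := faces _ _ _ _ f.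
have [ij jk kl li] := faceP f.
have il : edge i l by rewrite edgeC.
have lk : edge l k by rewrite edgeC.
have [nij _ xij] := edges _ _ ij; have [njk _ xjk] := edges _ _ jk.
have [nil _ xil] := edges _ _ il; have [nlk _ xlk] := edges _ _ lk.
have [[hi _ _] [hj _ _]] := (vert i, vert j); have [[hk _ _] [hl _ _]] := (vert k, vert l).
apply: (@diagonal_parallel _ _ _ _ _ _ (s i j / mprod (h i) (h j))
  (s j k / mprod (h j) (h k)) (s l k / mprod (h l) (h k))
  (s i l / mprod (h i) (h l)) _ _ hi hj hk hl _ _ _ _ s1 s2 s12 g1 g2).
- by rewrite divfK.
- by rewrite divfK ?e2.
- by rewrite (mprodC (h k)) divfK.
- by rewrite divfK.
- by rewrite -xij -xjk [RHS]addrC addrA subrK.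
- by rewrite -xil -xlk [RHS]addrC addrA subrK.
Qed.

Lemma dual_net_mixed_area i j k l : face i j k l -> mixed_area x h i j k l = 0.
Proof.
move=> f; have [vert edges faces] := net; have [ij jk kl li] := faceP f.
have [_ _ xij] := edges _ _ ij; have [_ _ xjk] := edges _ _ jk.
have [_ _ xkl] := edges _ _ kl; have [_ _ xli] := edges _ _ li.
rewrite (mixed_area_dual xij xjk xkl xli) -opprB.
have [t ->] := dual_net_diagonal f.
by rewrite -scaleNr wedgeZl wedgexx !scaler0.
Qed.

(** The plane is spanned by the edges of h at i. It contains x_k - x_i, which is parallel to h_j -
    h_l, hence also x_k - x_j, and therefore h_k - h_j. *)
Lemma dual_net_plane i j k l : face i j k l -> exists P Q,
  face_in_plane P Q x i j k l /\ face_in_plane P Q h i j k l.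
Proof.
move=> f; have [vert edges faces] := net; have [ij jk kl li] := faceP f.
have [_ _ xij] := edges _ _ ij; have [njk _ xjk] := edges _ _ jk.
have il : edge i l by rewrite edgeC.
have [_ _ xil] := edges _ _ il.
have [[e1 e2] [s1 s2 s12] g1 g2] := faces _ _ _ _ f.
have [t tE] := dual_net_diagonal f.
exists (h j - h i), (h l - h i).
have Pj : in_plane (h j - h i) (h l - h i) (h j - h i).
  by exists 1, 0; rewrite scale1r scale0r addr0.
have Pl : in_plane (h j - h i) (h l - h i) (h l - h i).
  by exists 0, 1; rewrite scale1r scale0r add0r.
have jl : h j - h l = (h j - h i) - (h l - h i) by rewrite opprB addrA subrK.
split; split => //.
- by rewrite xij -(opprB (h j) (h i)) scalerN -scaleNr; apply: in_planeZ.
- by rewrite tE jl; apply/in_planeZ/in_planeB.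
- by rewrite xil -(opprB (h l) (h i)) scalerN -scaleNr; apply: in_planeZ.
have c0 : s j k / mprod (h j) (h k) != 0 by rewrite mulf_neq0 ?invr_neq0 // -e2.
have -> : h k - h i = (h j - h i) - (h j - h k) by rewrite opprB [RHS]addrC addrA subrK.
apply: in_planeB => //.
have -> : h j - h k = (s j k / mprod (h j) (h k))^-1 *: ((x k - x i) - (x j - x i)).
  apply: (scalerI c0); rewrite scalerA mulfV // scale1r -xjk.
  by rewrite opprB addrA subrK.
apply/in_planeZ/in_planeB; first by rewrite tE jl; apply/in_planeZ/in_planeB.
by rewrite xij -(opprB (h j) (h i)) scalerN -scaleNr; apply: in_planeZ.
Qed.

(** Because s_ij != s_il, the second Gram condition gives (h_i,h_k) != 0, and three pairwise
    non-orthogonal null vectors are independent. *)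
Lemma dual_net_span G i j k l : (forall p, G p = <[h p]>%VS) -> face i j k l ->
  (3 <= \dim (G i + G j + G k + G l)%VS)%N.
Proof.
move=> GE f; have [vert edges faces] := net; have [ij jk kl li] := faceP f.
have [nij _ _] := edges _ _ ij; have [njk _ _] := edges _ _ jk.
have il : edge i l by rewrite edgeC.
have [nil _ _] := edges _ _ il.
have [_ [s1 s2 s12] _ g2] := faces _ _ _ _ f.
have nik : mprod (h i) (h k) != 0.
  apply: contraNneq s12 => ik; move: g2; rewrite ik !mul0r => /esym/eqP.
  by rewrite mulf_eq0 sqrf_eq0 subr_eq0 mulf_eq0 (negPf nil) (negPf njk).
have fr : free [:: h i; h j; h k].
  apply/(@freeP _ _ _ [tuple h i; h j; h k]) => c.
  rewrite !big_ord_recl big_ord0 addr0 /= addrA => rel.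
  have [[[hi _ _] [hj _ _]] [hk _ _]] := (vert i, vert j, vert k).
  have [c0 c1 c2] := null_independent hi hj hk nij njk nik rel.
  by case=> [[|[|[|//]]] p]; [rewrite -[RHS]c0|rewrite -[RHS]c1|rewrite -[RHS]c2];
    congr c; apply: val_inj.
have dim3 : \dim <<[:: h i; h j; h k]>>%VS = 3%N := eqP fr.
apply: (@leq_trans (\dim <<[:: h i; h j; h k]>>%VS)); first by rewrite dim3.
apply: dimvS; apply/span_subvP => v.
rewrite !inE => /or3P [] /eqP ->; rewrite !GE.
- by do 3!apply: (subvP (addvSl _ _)); rewrite memv_line.
- by do 2!apply: (subvP (addvSl _ _)); apply: (subvP (addvSr _ _)); rewrite memv_line.
by apply: (subvP (addvSl _ _)); apply: (subvP (addvSr _ _)); rewrite memv_line.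
Qed.

(** All mixed areas on a face are multiples of one bivector, so regularity of y yields H and K. With
    A(x,h) = 0, [weingarten_mixed_area] is then the Weingarten equation. Treating e = 1 and e = -1
    together covers both surfaces of the pair. *)
Lemma dual_net_weingarten (e : R) y G : e ^+ 2 = 1 -> (forall p, G p = <[h p]>%VS) ->
  (forall p, y p = x p - ((mu + e) / 2%:R) *: h p) ->
  regular y -> regular x -> linear_weingarten mu e y G.
Proof.
move=> e2 GE yE ry rx; have [vert edges faces] := net.
have hy p : mprod (h p) (y p) = 1.
  have [hh xh _] := vert p.
  by rewrite yE !mprod_lin hh mprodC xh mulr0 oppr0 addr0.
have h0 p : h p != 0 by apply: (@mprod_neq0l _ _ (y p)); rewrite hy oner_eq0.
have yy p : mprod (y p) (y p) = - e.
  have [hh xh xx] := vert p.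
  by rewrite {2}yE !mprod_lin [mprod (y p) (h p)]mprodC hy yE !mprod_lin xx mprodC xh; field.
have plane i j k l : face i j k l -> exists P Q,
   [/\ face_in_plane P Q y i j k l, face_in_plane P Q h i j k l & face_in_plane P Q x i j k l].
  move=> /dual_net_plane [P [Q [[xj xk xl] [hj hk hl]]]]; exists P, Q; split=> //.
  have sub p : y p - y i = (x p - x i) - ((mu + e) / 2%:R) *: (h p - h i).
    by rewrite !yE; apply/rowP=> q; rewrite !mxE; ring.
  by split; rewrite sub; apply/in_planeB/in_planeZ.
split.
- split=> [i j k l /plane [P [Q [yp _ _]]]|i j k l f]; first exact: face_in_plane_planar yp.
  (* The surface lies in a quadric centred at the origin. *)
  by exists 0; rewrite !subr0 !yy.
- exact: yy.
- split=> [p|].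
    rewrite /null_line GE dim_vline h0; split=> // v /vlineP [k ->].
    by have [hh _ _] := vert p; rewrite !mprod_lin hh !mulr0.
  split=> [p|i j ij].
    exists (y p), (G p); split=> //; rewrite /null_line GE dim_vline h0.
    split=> // v /vlineP [k ->].
    by have [hh _ _] := vert p; rewrite !mprod_lin hh !mulr0.
  have [_ _ xij] := edges _ _ ij; set c := _ / _ in xij.
  (* The edge equation x_j - x_i = c (h_i - h_j) says that x_i + c h_i = x_j + c h_j. *)
  exists (x i + c *: h i); rewrite /affine_line /=; split; rewrite /= GE yE.
    have -> : x i + c *: h i - (x i - ((mu + e) / 2%:R) *: h i) = (c + (mu + e) / 2%:R) *: h i.
      by apply/rowP=> q; rewrite !mxE; ring.
    by rewrite memvZ // memv_line.
  have -> : x i + c *: h i - (x j - ((mu + e) / 2%:R) *: h j) = (c + (mu + e) / 2%:R) *: h j.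
    apply/rowP=> q; have := congr1 (fun v : mink R => v 0 q) xij.
    by rewrite !mxE => E; rewrite -[x j 0 q](subrK (x i 0 q)) E; ring.
  by rewrite memvZ // memv_line.
- by split=> // p; exists (h p); rewrite ?GE ?memv_line // hy oner_eq0.
move=> g gl.
have mid p : middle_section mu e y g p = x p.
  have [k k0 gk] := lift_scale gl (GE p) (h0 p).
  by rewrite (middle_section_scale _ _ k0 gk (hy p)) yE subrK.
have gau p : gauss_map e y g p = - x p + ((mu - e) / 2%:R) *: h p.
  have [k k0 gk] := lift_scale gl (GE p) (h0 p).
  rewrite (gauss_map_scale _ k0 gk (hy p)) yE.
  by apply/rowP=> q; rewrite !mxE; field.
split=> [i j k l f|i j k l f].
  by rewrite /mixed_area !mid; apply: rx.
have [P [Q [yp hp xp]]] := plane _ _ _ _ f.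
have np : face_in_plane P Q (gauss_map e y g) i j k l.
  move: hp xp => [hj hk hl] [xj xk xl].
  have sub p : gauss_map e y g p - gauss_map e y g i =
      ((mu - e) / 2%:R) *: (h p - h i) - (x p - x i).
    by rewrite !gau; apply/rowP=> q; rewrite !mxE; ring.
  by split; rewrite sub; apply: in_planeB => //; apply: in_planeZ.
have [a aE] := mixed_area_plane yp yp; have [b bE] := mixed_area_plane yp np.
have [c cE] := mixed_area_plane np np.
have W0 : wedge P Q != 0.
  by apply: contraNneq (ry _ _ _ _ f) => W0; rewrite aE W0 scaler0.
have a0 : a != 0.
  by apply: contraNneq (ry _ _ _ _ f) => a0; rewrite aE a0 scale0r.
exists (- (b / a)), (c / a); split.
  rewrite /face_curvatures aE bE cE !scalerA divfK // mulNr divfK //.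
  by rewrite scaleNr !subrr.
have := weingarten_mixed_area i j k l yE gau.
rewrite dual_net_mixed_area // scaler0 aE bE cE !scalerA -!scalerDl => /eqP.
rewrite scaler_eq0 (negPf W0) orbF => /eqP rel.
transitivity (2%:R / a * ((mu + e) / 2%:R * c + ((mu + e) / 2%:R + (mu - e) / 2%:R) * b +
  (mu - e) / 2%:R * a)); first by field.
by rewrite rel mulr0.
Qed.

End Net.

Lemma dual_net_pair (mu : R) x h s (xp xm : Z2 -> mink R) G :
  dual_net mu x h s -> (forall p, G p = <[h p]>%VS) ->
  (forall p, xp p = x p - ((mu + 1) / 2%:R) *: h p) ->
  (forall p, xm p = x p - ((mu - 1) / 2%:R) *: h p) ->
  regular xp -> regular xm -> regular x -> BrLW_BiLW_pair mu xp xm G.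
Proof.
move=> net GE xpE xmE rp rm rx.
have wp := dual_net_weingarten net (expr1n _ 2) GE xpE rp rx.
have wm : linear_weingarten mu (-1) xm G.
  by apply: (dual_net_weingarten net _ GE) => //; rewrite sqrrN expr1n.
split=> //.
- by move=> i j k l f; exact: (dual_net_span net GE f).
- move=> i; apply/seteqP; split=> q; rewrite /affine_line /= GE xpE xmE => hq.
    rewrite -[q in q - _](subrK (xp i)) xpE -addrA; apply: memvD => //.
    have -> : x i - ((mu + 1) / 2%:R) *: h i - (x i - ((mu - 1) / 2%:R) *: h i) = (-1) *: h i.
      by apply/rowP=> p; rewrite !mxE; field.
    by rewrite memvZ // memv_line.
  rewrite -[q in q - _](subrK (xm i)) xmE -addrA; apply: memvD => //.
  have -> : x i - ((mu - 1) / 2%:R) *: h i - (x i - ((mu + 1) / 2%:R) *: h i) = h i.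
    by apply/rowP=> p; rewrite !mxE; field.
  by rewrite memv_line.
move=> g gl i; have [vert _ _] := net; have [hh xh xx] := vert i.
have hx : mprod (h i) (xp i) = 1 by rewrite xpE !mprod_lin hh mprodC xh mulr0 oppr0 addr0.
have h0 : h i != 0 by apply: (@mprod_neq0l _ _ (xp i)); rewrite hx oner_eq0.
have [k k0 gk] := lift_scale gl (GE i) h0.
rewrite (gauss_map_scale _ k0 gk hx) xmE xpE.
by apply/rowP=> p; rewrite !mxE; field.
Qed.

End DualNets.

(** * The Weierstrass-type representation *)

Section Weierstrass.

Variable R : realType.
Notation C := R[i].
Implicit Types (mu m s e t : R) (x g h : mink R) (P : 'M[C]_2) (p q z w : C).

Definition spinor p q : 'cV[C]_2 := \col_k if k == 0 then p else q.

Lemma dt_spinor p q : dt (spinor p 1) (spinor q 1) = p - q.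
Proof. by rewrite /dt !mxE /=; ring. Qed.

Lemma normc_sqr p : exists n : R, `|p| ^+ 2 = n%:C.
Proof.
case: p => a b; exists (Num.sqrt (a ^+ 2 + b ^+ 2) ^+ 2).
by rewrite rmorphXn.
Qed.

Lemma Nmx_spinor p : Nmx p = spinor_mx (spinor p 1).
Proof.
apply: mx2_eqP; rewrite [in LHS]mxE !mx2_entries !mxE /=.
- exact: normCK.
- by rewrite rmorph1 mulr1.
- by rewrite mul1r.
- by rewrite mul1r rmorph1.
Qed.

(** The origin of the matrices C^±: the middle section has the constant representative diag(1, -mu),
    and each surface differs from it by a multiple of the generator of G. *)
Lemma Cmx_decomposition mu s p : 1 - mu%:C * `|p| ^+ 2 != 0 ->
  Cmx mu s p = mx2 1 0 0 (- mu%:C) + ((mu + s)%:C / (1 - mu%:C * `|p| ^+ 2)) *: Nmx p.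
Proof.
move=> D0; apply: mx2_eqP; rewrite [LHS]mxE [RHS]mxE [X in _ = _ + X]mxE !mx2_entries
  ?rmorphD ?rmorphXn /=; field; exact: D0.
Qed.

(** Congruence by a matrix of determinant 1 preserves [bil], so the products are those of the normal
    forms. In particular mu |psi|^2 != 1 means that x^M is not orthogonal to G. *)
Lemma vertex_products mu e P p x g : e ^+ 2 = 1 -> \det P = 1 ->
  herm x = e%:C *: (P *m mx2 1 0 0 (- mu%:C) *m adjoint P) ->
  herm g = P *m Nmx p *m adjoint P ->
  (mprod x g)%:C = - 2%:R^-1 * (e%:C * (1 - mu%:C * `|p| ^+ 2)) /\ mprod x x = mu.
Proof.
move=> e2 dP xE gE.
have bilZ k (A B : 'M[C]_2) : bil (k *: A) B = k * bil A B by rewrite /bil !mxE; ring.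
have bilC (A B : 'M[C]_2) : bil A B = bil B A by rewrite /bil; ring.
split; first rewrite mprod_bil xE gE bilZ bil_adjoint dP rmorph1 !mul1r.
  by congr (_ * (_ * _)); rewrite /bil !mx2_entries; ring.
apply: complexI; rewrite mprod_bil xE bilZ bilC bilZ bil_adjoint dP rmorph1 !mul1r.
by rewrite mulrA -rmorphM -expr2 e2 rmorph1 mul1r /bil !mx2_entries; field.
Qed.

Lemma vertex_surface mu s e P p x g : e ^+ 2 = 1 -> \det P = 1 ->
  1 - mu%:C * `|p| ^+ 2 != 0 ->
  herm x = e%:C *: (P *m mx2 1 0 0 (- mu%:C) *m adjoint P) ->
  herm g = P *m Nmx p *m adjoint P ->
  herm (x - ((mu + s) / 2%:R) *: ((mprod x g)^-1 *: g)) =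
    e%:C *: (P *m Cmx mu s p *m adjoint P).
Proof.
move=> e2 dP D0 xE gE; have [xg _] := vertex_products e2 dP xE gE.
have eC : e%:C * e%:C = 1 :> C by rewrite -rmorphM -expr2 e2.
have eV : e%:C^-1 = e%:C :> C.
  have e0 : e%:C != 0 :> C.
    by apply: contra_eq_neq eC => ->; rewrite mul0r eq_sym oner_eq0.
  by apply: (mulfI e0); rewrite mulfV.
rewrite hermD hermN !hermZ xE gE (Cmx_decomposition s D0) mulmxDr mulmxDl scalerDr.
congr (_ + _); rewrite scalerA -scaleNr -scalemxAr -scalemxAl scalerA; congr (_ *: _).
by rewrite !(rmorphM, fmorphV) /= xg !invfM eV rmorph_nat invrN invrK; field.
Qed.

(** As w^2 is real, conj w is s w or -s w; the latter would give |w|^2 = -s t < 0. *)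
Lemma conj_sqrt_real w t s : w ^+ 2 = t%:C -> s ^+ 2 = 1 -> 0 < s * t ->
  Num.conj w = s%:C * w.
Proof.
move=> wt s2 st.
have : (Num.conj w - s%:C * w) * (Num.conj w + s%:C * w) = 0.
  transitivity (Num.conj (w ^+ 2) - (s ^+ 2)%:C * w ^+ 2); first by ring.
  by rewrite s2 rmorph1 mul1r wt conj_real subrr.
move/eqP; rewrite mulf_eq0 subr_eq0 => /orP [/eqP //|/eqP].
move=> /(canRL (addrK _)); rewrite add0r => wc.
have : 0 <= w * Num.conj w by apply: mul_conjC_ge0.
rewrite wc mulrN mulrCA -expr2 wt -rmorphM -rmorphN /= -(rmorph0 (real_complex R)) lecR.
by rewrite oppr_ge0 leNgt st.
Qed.

(** The eigenvectors of B_ij are (psi_i, 1) and (psi_j, 1), with eigenvalues r'/r and r/r'. *)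
Lemma Bmx_boost m a (r r' p q : C) : p != q -> r != 0 -> r' != 0 ->
  r ^+ 2 = a%:C -> r' ^+ 2 = (a + m)%:C ->
  Bmx m a r r' p q = boost (r / r') (spinor p 1) (spinor q 1).
Proof.
move=> pq r0 r0' rE rE'.
have pq0 : p - q != 0 by rewrite subr_eq0.
have mE : m%:C = r' ^+ 2 - r ^+ 2 by rewrite rE rE' rmorphD addrC addKr.
apply: boost_unique.
- by rewrite mulf_neq0 ?invr_neq0.
- by rewrite dt_spinor.
- apply: spinor_eqP; rewrite mulmx2E !mxE /= mE -rE; field; by rewrite r0 r0' pq0.
- apply: spinor_eqP; rewrite mulmx2E !mxE /= mE -rE; field; by rewrite r0 r0' pq0.
Qed.

(* Turns the translation produced by [boost_herm] into an edge of a dual net. *)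
Lemma edge_step x g x' g' t : t != 0 -> mprod g g' != 0 -> mprod x g != 0 ->
  mprod x' g' != 0 -> mprod x g' = t * mprod x' g' ->
  x + ((1 - t) / t * mprod x g' / mprod g g') *: g -
    ((1 - t) * mprod x g / mprod g g') *: g' =
  x + ((1 - t) / mprod ((mprod x g)^-1 *: g) ((mprod x' g')^-1 *: g')) *:
    ((mprod x g)^-1 *: g - (mprod x' g')^-1 *: g').
Proof.
move=> t0 gg xg xg' e; rewrite -addrA; congr (_ + _).
rewrite scalerBr !scalerA !mprod_lin; congr (_ *: _ - _ *: _); rewrite ?e; field;
  by rewrite ?t0 gg xg xg'.
Qed.

Lemma edge_face (i j : Z2) : edge i j -> exists k l, face i j k l.
Proof.
move/edgeP; case: i => x y /= [] ->.
- exists (x + 1, y + 1), (x, y + 1); rewrite /face /edge /=.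
  by apply/and5P; split; [lia|lia|lia|lia|apply/andP; split; apply/eqP => -[]; lia].
- exists (x - 1, y + 1), (x, y + 1); rewrite /face /edge /=.
  by apply/and5P; split; [lia|lia|lia|lia|apply/andP; split; apply/eqP => -[]; lia].
- exists (x + 1, y + 1), (x + 1, y); rewrite /face /edge /=.
  by apply/and5P; split; [lia|lia|lia|lia|apply/andP; split; apply/eqP => -[]; lia].
- exists (x + 1, y - 1), (x + 1, y); rewrite /face /edge /=.
  by apply/and5P; split; [lia|lia|lia|lia|apply/andP; split; apply/eqP => -[]; lia].
Qed.

End Weierstrass.

(** * The dual net of given holomorphic data *)

Section WeierstrassNet.

Variables (R : realType) (mu m : R).
Notation C := R[i].
Variables (psi : Z2 -> C) (ml : Z2 -> Z2 -> R) (r r' : Z2 -> Z2 -> C).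
Variables (Psi : Z2 -> 'M[C]_2) (e : Z2 -> R).
Hypothesis data : weierstrass_data mu m psi ml r r' Psi e.
Variables (x g : Z2 -> mink R).
Hypothesis xE : forall i,
  herm (x i) = (e i)%:C *: (Psi i *m mx2 1 0 0 (- mu%:C) *m adjoint (Psi i)).
Hypothesis gE : forall i, herm (g i) = Psi i *m Nmx (psi i) *m adjoint (Psi i).

Let v i := Psi i *m spinor (psi i) 1.
Let w i j := r i j / r' i j.
Let t i j := ml i j / (ml i j + m).
Let h i := (mprod (x i) (g i))^-1 *: g i.

Let scalemx_mid (k : C) (A B D : 'M[C]_2) : A *m (k *: B) *m D = k *: (A *m B *m D).
Proof. by rewrite -scalemxAr -scalemxAl. Qed.

Let e2 i : e i ^+ 2 = 1.
Proof.
by have [_ _ _ _ [_ [he _]]] := data; case: (he i) => ->; rewrite ?sqrrN expr1n.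
Qed.

Let gv i : herm (g i) = spinor_mx (v i).
Proof. by rewrite gE Nmx_spinor spinor_mx_mul. Qed.

Let label_neq0 i j : edge i j -> ml i j != 0 /\ ml i j + m != 0.
Proof.
by have [[hol _] [_ hm] _ _ _] := data; move=> ij; have [_ ?] := hol _ _ ij; have := hm _ _ ij.
Qed.

Let sqrtE i j : edge i j ->
  [/\ r i j != 0, r' i j != 0, r i j ^+ 2 = (ml i j)%:C & r' i j ^+ 2 = (ml i j + m)%:C].
Proof.
move=> ij; have [_ _ [[hr _] [hr' _]] _ _] := data.
have [_ rE] := hr _ _ ij; have [_ rE'] := hr' _ _ ij.
have [m0 mm0] := label_neq0 ij.
split=> //; rewrite -sqrf_eq0 ?rE ?rE' fmorph_eq0 //.
Qed.

Let w0 i j : edge i j -> w i j != 0.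
Proof. by move=> /sqrtE [r0 r0' _ _]; rewrite mulf_neq0 ?invr_neq0. Qed.

Let w2 i j : edge i j -> w i j ^+ 2 = (t i j)%:C.
Proof.
by move=> /sqrtE [_ _ rE rE']; rewrite exprMn exprVn rE rE' rmorphM fmorphV.
Qed.

Let t0 i j : edge i j -> t i j != 0.
Proof. by move=> /label_neq0 [? ?]; rewrite mulf_neq0 ?invr_neq0. Qed.

Let wc i j : edge i j -> Num.conj (w i j) = (e i * e j)%:C * w i j.
Proof.
move=> ij; apply: conj_sqrt_real (w2 ij) _ _; first by rewrite exprMn !e2 mulr1.
have [_ _ _ _ [_ [_ he]]] := data; have [m0 mm0] := label_neq0 ij.
have := he _ _ ij; rewrite /t.
(* The numbers m_ij (m_ij + m) and t_ij differ by a square, so e_i e_j is the sign of t_ij. *)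
have -> : e i * e j * (ml i j * (ml i j + m)) =
   (e i * e j * (ml i j / (ml i j + m))) * (ml i j + m) ^+ 2 by field.
by rewrite pmulr_lgt0 // lt0r sqr_ge0 expf_neq0.
Qed.

Let psi_neq i j : edge i j -> psi i != psi j.
Proof.
move=> /edge_face [k [l f]]; have [[_ hol] _ _ _ _] := data.
have [_ _ cr /ltr0_neq0 ne] := hol _ _ _ _ f.
rewrite -subr_eq0; apply: contra_eq_neq cr => ->.
by rewrite !mul0r eq_sym fmorph_eq0.
Qed.

Let vj i j : edge i j -> v j = w i j *: (Psi i *m spinor (psi j) 1).
Proof.
move=> ij; have [_ _ _ [_ hPsi] _] := data; have [r0 r0' rE rE'] := sqrtE ij.
rewrite /v (hPsi _ _ ij) (Bmx_boost (psi_neq ij) r0 r0' rE rE') -mulmxA.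
rewrite (@boost_snd _ _ (spinor (psi i) 1)) ?scalemxAr //; first exact: w0.
by rewrite dt_spinor subr_eq0 psi_neq.
Qed.

Let dtv i j : edge i j -> dt (v i) (v j) = w i j * (psi i - psi j).
Proof.
move=> ij; have [_ _ _ [dPsi _] _] := data.
by rewrite (vj ij) dtZr dt_mul dPsi mul1r dt_spinor.
Qed.

(** The right factor B_ij is conjugated to the left. Transporting its second eigenvector gives [v j]
    only up to the factor w_ij, which a boost ignores. *)
Let Psij i j : edge i j -> Psi j = boost (w i j) (v i) (v j) *m Psi i.
Proof.
move=> ij; have [_ _ _ [dPsi hPsi] _] := data; have [r0 r0' rE rE'] := sqrtE ij.
have d0 : dt (spinor (psi i) 1) (spinor (psi j) 1) != 0.
  by rewrite dt_spinor subr_eq0 psi_neq.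
have dP : \det (Psi i) != 0 by rewrite dPsi oner_eq0.
have dv : dt (v i) (Psi i *m spinor (psi j) 1) != 0 by rewrite dt_mul mulf_neq0.
rewrite (vj ij) -[v i]scale1r (boostZ (w0 ij) (oner_neq0 _) (w0 ij) dv).
rewrite (boost_conj (w0 ij) d0 dP) {1}(hPsi _ _ ij).
by rewrite (Bmx_boost (psi_neq ij) r0 r0' rE rE').
Qed.

Let D0 i : 1 - mu%:C * `|psi i| ^+ 2 != 0.
Proof. by have [_ _ _ _ [he _]] := data; rewrite subr_eq0 eq_sym he. Qed.

Let xg i : mprod (x i) (g i) != 0.
Proof.
have [_ _ _ [dPsi _] _] := data.
have [xgE _] := vertex_products (e2 i) (dPsi i) (xE i) (gE i).
have e0 : e i != 0 by apply: contra_eq_neq (e2 i) => ->; rewrite expr0n eq_sym oner_eq0.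
have : (mprod (x i) (g i))%:C != 0 :> C.
  by rewrite xgE !mulf_neq0 ?oppr_eq0 ?invr_eq0 ?pnatr_eq0 ?fmorph_eq0 ?D0.
by rewrite fmorph_eq0.
Qed.

Let gg i j : edge i j -> mprod (g i) (g j) != 0.
Proof.
move=> ij; rewrite (mprod_spinors_neq0 (gv i) (gv j)) (dtv ij) mulf_neq0 ?w0 //.
by rewrite subr_eq0 psi_neq.
Qed.

(** By [boost_herm] the frame moves x_i by a combination of g_i and g_j, the sign e_i e_j cancelling
    that of the congruence. Pairing with g_j gives (x_i,g_j) = t_ij (x_j,g_j), which turns both
    coefficients into one. *)
Lemma weierstrass_edge i j : edge i j ->
  x j - x i = ((1 - t i j) / mprod (h i) (h j)) *: (h i - h j).
Proof.
move=> ij; have d0 : dt (v i) (v j) != 0.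
  by rewrite -(mprod_spinors_neq0 (gv i) (gv j)) gg.
have ee2 : (e i * e j) ^+ 2 = 1 by rewrite exprMn !e2 mulr1.
have eiC : (e i)%:C * (e i)%:C = 1 :> C by rewrite -rmorphM -expr2 e2.
have := boost_herm (x i) (w0 ij) d0 (w2 ij) (wc ij) ee2 (gv i) (gv j).
set y := x i + _ - _ => step.
have xy : x j = y.
  apply: herm_inj; rewrite xE (Psij ij) adjointM.
  transitivity ((e j * e i)%:C *: (boost (w i j) (v i) (v j) *m herm (x i) *m
    adjoint (boost (w i j) (v i) (v j)))).
    rewrite [in RHS]xE scalemx_mid [RHS]scalerA !mulmxA; congr (_ *: _).
    by rewrite rmorphM /= -mulrA eiC mulr1.
  by rewrite step scalerA -rmorphM /= (mulrC (e j)) -expr2 ee2 scale1r.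
have gj0 : mprod (g j) (g j) = 0 := mprod_spinor_null (gv j).
have xgt : mprod (x i) (g j) = t i j * mprod (x j) (g j).
  rewrite xy /y !mprod_lin gj0; field.
  by rewrite t0 // gg.
rewrite xy /y (edge_step (t0 ij) (gg ij) (xg i) (xg j) xgt).
by rewrite addrC addKr.
Qed.

(** Passing from psi to the spinors v multiplies the cross-ratio m_il/m_ij by w_ij^2/w_il^2 =
    t_ij/t_il, and the result (m_il + m)/(m_ij + m) is the quotient of the numbers 1 - t. *)
Lemma weierstrass_cross_ratio i j k l : face i j k l ->
  (1 - t i l)%:C * (dt (v i) (v j) * dt (v k) (v l)) =
  (1 - t i j)%:C * (dt (v j) (v k) * dt (v l) (v i)).
Proof.
move=> f; have [[sym hol] _ [[hr fr] [hr' fr']] _ _] := data.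
have [ij jk kl li] := faceP f; have il : edge i l by rewrite edgeC.
have lk : edge l k by rewrite edgeC.
have [_ _ cr _] := hol _ _ _ _ f.
have [r1 r2] := fr _ _ _ _ f; have [r1' r2'] := fr' _ _ _ _ f.
have wkl : w k l = w i j.
  by rewrite /w (hr _ _ kl).1 (hr' _ _ kl).1 r1 r1'.
have wjk : w j k = w i l by rewrite /w r2 r2'.
have wli : w l i = w i l by rewrite /w (hr _ _ li).1 (hr' _ _ li).1.
rewrite !dtv // wkl wjk wli.
have [m1 mm1] := label_neq0 ij; have [m2 mm2] := label_neq0 il.
have jk0 : psi j - psi k != 0 by rewrite subr_eq0 psi_neq.
have li0 : psi l - psi i != 0 by rewrite subr_eq0 psi_neq.
have cr' : (psi i - psi j) * (psi k - psi l) =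
    (ml i l / ml i j)%:C * ((psi j - psi k) * (psi l - psi i)).
  by rewrite -cr; field; rewrite jk0 li0.
transitivity ((1 - t i l)%:C * w i j ^+ 2 * ((psi i - psi j) * (psi k - psi l))).
  by ring.
rewrite cr' (w2 ij).
transitivity ((1 - t i j)%:C * w i l ^+ 2 * ((psi j - psi k) * (psi l - psi i))).
  rewrite (w2 il) mulrA -!rmorphM; congr (_%:C * _); rewrite /t; field.
  by rewrite m1 mm1 mm2.
by ring.
Qed.

Lemma weierstrass_dual_net : dual_net mu x h (fun i j => 1 - t i j).
Proof.
have [[sym hol] [m0 _] [[hr fr] [hr' fr']] [dPsi _] _] := data.
have tE i j : edge i j -> 1 - t i j = m / (ml i j + m).
  by move=> /label_neq0 [? ?]; rewrite /t; field.
have hh i j : mprod (h i) (h j) =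
    (mprod (x i) (g i))^-1 * (mprod (x j) (g j))^-1 * mprod (g i) (g j).
  by rewrite !mprod_lin mulrA.
split=> [i|i j ij|i j k l f].
- have [_ xx] := vertex_products (e2 i) (dPsi i) (xE i) (gE i).
  split=> //; last by rewrite mprodZr mulVf.
  by rewrite hh (mprod_spinor_null (gv i)) mulr0.
- split; last exact: weierstrass_edge.
    by rewrite hh !mulf_neq0 ?invr_eq0 ?xg // gg.
  by rewrite /t (sym _ _ ij).1.
have [ij jk kl li] := faceP f; have il : edge i l by rewrite edgeC.
have [m1 m2 _ neg] := hol _ _ _ _ f.
have s20 : 1 - t i l != 0.
  by rewrite tE // mulf_neq0 // invr_neq0 //; have [] := label_neq0 il.
split.
- by rewrite /t m1 m2.
- split=> //.
    by rewrite tE // mulf_neq0 // invr_neq0 //; have [] := label_neq0 ij.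
  (* Equal values would force m_ij = m_il, but their quotient is negative. *)
  rewrite !tE //; apply: contraTneq neg => /(mulfI m0)/invr_inj/addIr ->.
  by have [mil _] := label_neq0 il; rewrite divff // ltr10.
- have [g1 _] := (gram_cross_ratio (1 - t i j) (gv i) (gv j) (gv k) (gv l) s20).1
    (weierstrass_cross_ratio f).
  rewrite !hh; set a := _^-1; set b := _^-1; set c := _^-1; set d := _^-1.
  transitivity (a * b * c * d * (mprod (g i) (g j) * mprod (g k) (g l) * (1 - t i l) ^+ 2)).
    by ring.
  by rewrite g1; ring.
have [_ g2] := (gram_cross_ratio (1 - t i j) (gv i) (gv j) (gv k) (gv l) s20).1
    (weierstrass_cross_ratio f).
rewrite !hh; set a := (mprod (x i) _)^-1; set b := (mprod (x k) _)^-1.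
set c := (mprod (x j) _)^-1; set d := (mprod (x l) _)^-1.
transitivity (a * b * c * d * (mprod (g i) (g k) * mprod (g j) (g l) * (1 - t i l) ^+ 2)).
  by ring.
by rewrite g2; ring.
Qed.

Lemma weierstrass_label_sign i j k l : face i j k l ->
  (t i j * (1 - t i j)) * (t i l * (1 - t i l)) < 0.
Proof.
move=> f; have [[sym hol] [m0 _] _ _ _] := data.
have [ij jk kl li] := faceP f; have il : edge i l by rewrite edgeC.
have [_ _ _ neg] := hol _ _ _ _ f.
have [m1 mm1] := label_neq0 ij; have [m2 mm2] := label_neq0 il.
have -> : (t i j * (1 - t i j)) * (t i l * (1 - t i l)) =
  (ml i l / ml i j) * (m * ml i j / ((ml i j + m) * (ml i l + m))) ^+ 2.
  by rewrite /t; field; rewrite m1 mm1 mm2.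
rewrite nmulr_rlt0 // lt0r sqr_ge0 andbT expf_neq0 //.
by rewrite !mulf_neq0 // invr_neq0 // mulf_neq0.
Qed.

End WeierstrassNet.

(** * Dual nets and pairs of surfaces *)

Section Pairs.

Variable R : realType.
Notation C := R[i].
Implicit Types (x h g : Z2 -> mink R) (G : Z2 -> {vspace mink R}).

Lemma vline_scale (k : R) (u : mink R) : k != 0 -> <[k *: u]>%VS = <[u]>%VS.
Proof.
move=> k0; apply/eqP; rewrite eqEsubv -!memvE memvZ ?memv_line //=.
by rewrite -{1}[u](scalerK k0) memvZ // memv_line.
Qed.

Definition label_signs (s : Z2 -> Z2 -> R) : Prop := forall i j k l, face i j k l ->
  ((1 - s i j) * s i j) * ((1 - s i l) * s i l) < 0.

Lemma dual_net_middle mu x h s (xp : Z2 -> mink R) G g :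
  dual_net mu x h s -> (forall p, G p = <[h p]>%VS) ->
  (forall p, xp p = x p - ((mu + 1) / 2%:R) *: h p) -> is_lift g G ->
  middle_section mu 1 xp g = x /\
  (forall i j, mprod (g i) (x j) / mprod (g i) (x i) = mprod (h i) (x j)).
Proof.
move=> [vert _ _] GE xpE gl.
have xh p : mprod (h p) (x p) = 1 by have [_ + _] := vert p; rewrite mprodC.
have h0 p : h p != 0 by apply: (@mprod_neq0l _ _ (x p)); rewrite xh oner_eq0.
split.
  apply: funext => p; have [k k0 gk] := lift_scale gl (GE p) (h0 p).
  have hxp : mprod (h p) (xp p) = 1.
    by have [hh _ _] := vert p; rewrite xpE !mprod_lin hh xh mulr0 oppr0 addr0.
  by rewrite (middle_section_scale _ _ k0 gk hxp) xpE subrK.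
move=> i j; have [k k0 gk] := lift_scale gl (GE i) (h0 i).
by rewrite gk !mprodZl xh; field.
Qed.

Lemma dual_net_opposite_labels mu x h s (xp : Z2 -> mink R) G :
  dual_net mu x h s -> (forall p, G p = <[h p]>%VS) ->
  (forall p, xp p = x p - ((mu + 1) / 2%:R) *: h p) -> label_signs s ->
  opposite_labels mu xp G.
Proof.
move=> net GE xpE sg g gl; have [-> tE] := dual_net_middle net GE xpE gl.
rewrite /= => i j k l f; rewrite !tE.
have [vert edges _] := net; have [ij jk kl li] := faceP f.
have il : edge i l by rewrite edgeC.
have lab p q : edge p q -> mprod (h p) (x q) = 1 - s p q.
  move=> pq; have [nz _ e] := edges _ _ pq; have [hh xh _] := vert p.
  rewrite -[x q](subrK (x p)) e !mprod_lin hh sub0r mulrN divfK // addrC.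
  by rewrite mprodC xh.
by rewrite !lab // !subKr; apply: sg f.
Qed.

Lemma weierstrass_net (mu m : R) psi ml r r' Psi e xp xm G :
  weierstrass_data mu m psi ml r r' Psi e ->
  weierstrass_surface mu 1 psi Psi e xp -> weierstrass_surface mu (-1) psi Psi e xm ->
  weierstrass_gauss psi Psi G ->
  exists x h s, [/\ dual_net mu x h s, label_signs s, forall p, G p = <[h p]>%VS,
    forall p, xp p = x p - ((mu + 1) / 2%:R) *: h p &
    forall p, xm p = x p - ((mu - 1) / 2%:R) *: h p].
Proof.
move=> data xpE xmE gauss.
have [_ _ _ [dPsi _] [hmu [he _]]] := data.
have e2 i : e i ^+ 2 = 1 by case: (he i) => ->; rewrite ?sqrrN expr1n.
have D0 i : 1 - mu%:C * `|psi i| ^+ 2 != 0 by rewrite subr_eq0 eq_sym hmu.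
have /choice [g gE] : forall i, exists v : mink R, G i = <[v]>%VS /\
    herm v = Psi i *m Nmx (psi i) *m adjoint (Psi i).
  by move=> i; have [v ? ?] := gauss i; exists v.
have /choice [x xE] : forall i, exists x : mink R,
    herm x = (e i)%:C *: (Psi i *m mx2 1 0 0 (- mu%:C) *m adjoint (Psi i)).
  move=> i; have [n nE] := normc_sqr (psi i).
  have DE : 1 - mu%:C * `|psi i| ^+ 2 = (1 - mu * n)%:C.
    by rewrite nE rmorphB rmorph1 rmorphM.
  (* Undoing [Cmx_decomposition] presents the matrix as [herm] of a real vector. *)
  exists (xp i - (e i * ((mu + 1) / (1 - mu * n))) *: g i).
  rewrite hermD hermN hermZ xpE (gE i).2 (Cmx_decomposition 1 (D0 i)) DE.
  rewrite mulmxDr mulmxDl scalerDr -scalemxAr -scalemxAl scalerA.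
  by rewrite -fmorphV -rmorphM -rmorphM addrK.
have hg i : herm (g i) = Psi i *m Nmx (psi i) *m adjoint (Psi i) := (gE i).2.
have net := weierstrass_dual_net data xE hg.
exists x, (fun i => (mprod (x i) (g i))^-1 *: g i), (fun i j => 1 - ml i j / (ml i j + m)).
split=> //.
- move=> i j k l f; rewrite !subKr.
  exact: (weierstrass_label_sign data f).
- move=> p; have [vert _ _] := net; have [_ xh _] := vert p.
  rewrite vline_scale; first exact: (gE p).1.
  apply: contra_eq_neq xh => ->; by rewrite scale0r mprodC mprod0l eq_sym oner_eq0.
- move=> p; apply: herm_inj.
  by rewrite xpE (vertex_surface 1 (e2 p) (dPsi p) (D0 p) (xE p) (hg p)).
- move=> p; apply: herm_inj.
  by rewrite xmE (vertex_surface (-1) (e2 p) (dPsi p) (D0 p) (xE p) (hg p)).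
Qed.

Lemma null_line_gen (U : {vspace mink R}) : \dim U = 1%N -> U = <[vpick U]>%VS.
Proof.
move=> d1; apply/eqP; rewrite eq_sym eqEdim -memvE memv_pick d1 dim_vline vpick0.
by rewrite -dimv_eq0 d1.
Qed.

(** The Legendre condition gives the edge equations and the Weingarten equation gives A(x,h) = 0.
    The remaining work is to show that the diagonal products of h are nonzero, so that
    [dual_face_gram] yields the Gram conditions. *)
Lemma pair_dual_net mu xp xm G : BrLW_BiLW_pair mu xp xm G -> opposite_labels mu xp G ->
  exists x h s, [/\ dual_net mu x h s, label_signs s, forall p, G p = <[h p]>%VS,
    forall p, xp p = x p - ((mu + 1) / 2%:R) *: h p &
    forall p, xm p = x p - ((mu - 1) / 2%:R) *: h p].
Proof.
case=> -[_ xx [nullG [_ meet]] [perp _] wein] _ dim3 _ xmE opp.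
pose g i := vpick (G i).
have gl : is_lift g G by move=> i; apply: null_line_gen; have [] := nullG i.
have gg i : mprod (g i) (g i) = 0 by have [_ ->] := nullG i; rewrite ?memv_pick.
have gx i : mprod (g i) (xp i) != 0.
  have [v] := perp i; rewrite gl => /vlineP [k ->].
  by rewrite mprodZl mulf_eq0 negb_or => /andP [].
pose h i := (mprod (g i) (xp i))^-1 *: g i.
have hh i : mprod (h i) (h i) = 0 by rewrite !mprod_lin gg !mulr0.
have hxp i : mprod (h i) (xp i) = 1 by rewrite mprodZl mulVf.
have h0 i : h i != 0 by apply: (@mprod_neq0l _ _ (xp i)); rewrite hxp oner_eq0.
have GE i : G i = <[h i]>%VS by rewrite vline_scale ?invr_eq0.
have gk i : g i = mprod (g i) (xp i) *: h i by rewrite scalerA divff ?scale1r.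
clearbody h; pose x i := xp i + ((mu + 1) / 2%:R) *: h i.
have xE i : x i = xp i + ((mu + 1) / 2%:R) *: h i by [].
have xpE i : xp i = x i - ((mu + 1) / 2%:R) *: h i by rewrite xE addrK.
clearbody x.
have hx i : mprod (h i) (x i) = 1 by rewrite xE !mprod_lin hxp hh mulr0 addr0.
have xh i : mprod (x i) (h i) = 1 by rewrite mprodC.
have mid : middle_section mu 1 xp g = x.
  by apply: funext => i; rewrite (middle_section_scale _ _ (gx i) (gk i) (hxp i)) xE.
have gau i : gauss_map 1 xp g i = - x i + ((mu - 1) / 2%:R) *: h i.
  rewrite (gauss_map_scale _ (gx i) (gk i) (hxp i)) xE.
  by apply/rowP=> q; rewrite !mxE; field.
have := opp g gl; rewrite mid /= => lab.
have tE i j : mprod (g i) (x j) / mprod (g i) (x i) = mprod (h i) (x j).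
  by rewrite gk !mprodZl hx; field.
pose s i j := 1 - mprod (h i) (x j).
have sg : label_signs s.
  by move=> i j k l /lab; rewrite !tE /s !subKr.
have snz i j : edge i j -> s i j != 0.
  move=> /edge_face [k [l /sg]]; apply: contraTneq => ->.
  by rewrite mulr0 mul0r ltxx.
have edges i j : edge i j -> [/\ mprod (h i) (h j) != 0, s i j = s j i &
        x j - x i = (s i j / mprod (h i) (h j)) *: (h i - h j)].
  move=> ij; have := meet _ _ ij; case=> q; rewrite /affine_line /= !GE.
  case=> /vlineP [a qa] /vlineP [b qb].
  (* The common point q = x^+_i + a h_i = x^+_j + b h_j has (q,q) = 2a - 1 = 2b - 1, which makes x
     and h edge-parallel. *)
  have ab : a = b.
    have qi : q = xp i + a *: h i by rewrite -qa addrC subrK.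
    have qj : q = xp j + b *: h j by rewrite -qb addrC subrK.
    have : mprod q q = 2%:R * a - 1.
      by rewrite qi !mprod_lin hh xx [mprod (xp i) (h i)]mprodC hxp; ring.
    rewrite {1 2}qj !mprod_lin hh xx [mprod (xp j) (h j)]mprodC hxp; lra.
  have xij : x j - x i = (a - (mu + 1) / 2%:R) *: (h i - h j).
    apply/rowP=> p; have := congr1 (fun v : mink R => v 0 p) qa.
    have := congr1 (fun v : mink R => v 0 p) qb; rewrite !xE -ab !mxE => f1 f2.
    have -> : xp j 0 p = q 0 p - a * h j 0 p by rewrite -f1 subKr.
    have -> : xp i 0 p = q 0 p - a * h i 0 p by rewrite -f2 subKr.
    by ring.
  set c := a - _ in xij.
  have sij : s i j = c * mprod (h i) (h j).
    rewrite /s -[x j](subrK (x i)) xij !mprod_lin hh hx; ring.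
  have hhij : mprod (h i) (h j) != 0.
    by apply: contraNneq (snz _ _ ij) => e0; rewrite sij e0 mulr0.
  split=> //; last by rewrite xij sij mulfK.
  rewrite sij /s -[x i](subKr (x j)) xij !mprod_lin hh hx [mprod (h j) (h i)]mprodC; ring.
exists x, h, s; split=> //; last first.
  move=> p; rewrite (xmE g gl) gau; apply/rowP=> q; rewrite !mxE; ring.
have [mreg curv] := wein g gl; rewrite mid in mreg.
split=> // [i|i j k l f].
  by split=> //; rewrite {2}xE !mprod_lin xh xE !mprod_lin xx hxp; field.
have [ij jk kl li] := faceP f; have il : edge i l by rewrite edgeC.
have lk : edge l k by rewrite edgeC.
have [nij _ xij] := edges _ _ ij; have [njk _ xjk] := edges _ _ jk.
have [nkl _ xkl] := edges _ _ kl; have [nli _ xli] := edges _ _ li.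
have [nil _ xil] := edges _ _ il; have [nlk _ xlk] := edges _ _ lk.
have area0 : mixed_area x h i j k l = 0.
  have [H [K [[c1 c2] lw]]] := curv _ _ _ _ f.
  have := weingarten_mixed_area i j k l xpE gau.
  have -> : mixed_area xp (gauss_map 1 xp g) i j k l = - (H *: mixed_area xp xp i j k l).
    by apply/eqP; rewrite -addr_eq0 c1.
  have -> : mixed_area (gauss_map 1 xp g) (gauss_map 1 xp g) i j k l =
      K *: mixed_area xp xp i j k l by apply/eqP; rewrite -subr_eq0 c2.
  move: (mixed_area xp xp i j k l) (mixed_area x h i j k l) => A B.
  rewrite scalerN !scalerA -scaleNr -!scalerDl => E.
  have one : ((mu + 1) / 2%:R - (mu - 1) / 2%:R) ^+ 2 = 1 by field.
  rewrite one scale1r in E; rewrite -E.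
  have -> : (mu + 1) / 2%:R * K - ((mu + 1) / 2%:R + (mu - 1) / 2%:R) * H +
      (mu - 1) / 2%:R = 0.
    transitivity (((mu + 1) * K - 2%:R * mu * H + (mu - 1)) / 2%:R); first by field.
    by rewrite lw mul0r.
  by rewrite scale0r.
have w1 : wedge (x i - x k) (h j - h l) = 0.
  have := mixed_area_dual xij xjk xkl xli; rewrite area0 => /esym/eqP.
  by rewrite scaler_eq0 invr_eq0 pnatr_eq0 => /eqP.
have w2 : wedge (x j - x l) (h i - h k) = 0.
  have := edge_parallel_diagonals xij xjk xkl xli; rewrite w1 => /esym/eqP.
  by rewrite oppr_eq0 => /eqP.
have W0 : wedge (x i - x k) (x j - x l) != 0.
  by apply: contraNneq (mreg _ _ _ _ f) => W0; rewrite mixed_areaxx W0 scaler0.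
have xik0 : x k - x i != 0.
  apply: contraNneq W0 => e0; rewrite -opprB e0 oppr0.
  by apply/eqP/matrixP=> a b; rewrite wedgeE !mxE; ring.
have xjl0 : x l - x j != 0.
  apply: contraNneq W0 => e0; rewrite -(opprB (x l)) e0 oppr0.
  by apply/eqP/matrixP=> a b; rewrite wedgeE !mxE; ring.
have w1' : wedge (x k - x i) (h j - h l) = 0.
  by rewrite -(opprB (x i)) -(scaleN1r (x i - x k)) wedgeZl w1 scaler0.
have w2' : wedge (x l - x j) (h i - h k) = 0.
  by rewrite -(opprB (x j)) -(scaleN1r (x j - x l)) wedgeZl w2 scaler0.
set c1 := s i j / _ in xij; set c2 := s j k / _ in xjk.
set c1' := s l k / _ in xlk; set c2' := s i l / _ in xil.
have c10 : c1 != 0 by rewrite mulf_neq0 ?snz ?invr_eq0.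
have c20 : c2 != 0 by rewrite mulf_neq0 ?snz ?invr_eq0.
have c10' : c1' != 0 by rewrite mulf_neq0 ?snz ?invr_eq0.
have c20' : c2' != 0 by rewrite mulf_neq0 ?snz ?invr_eq0.
have xki : x k - x i = c1 *: (h i - h j) + c2 *: (h j - h k).
  by rewrite -xij -xjk [RHS]addrC addrA subrK.
have xki' : x k - x i = c2' *: (h i - h l) + c1' *: (h l - h k).
  by rewrite -xil -xlk [RHS]addrC addrA subrK.
have xlj : x l - x j = c2' *: (h i - h l) - c1 *: (h i - h j).
  by rewrite -xil -xij opprB addrA subrK.
(* By [dual_face_diagonal_neq0], applied to the face and to its rotation, either inequality implies
   the other. If both products vanished, h_k and h_l would be multiples of h_i and h_j, and the four
   lines would span at most a plane. *)
have [nik njl] : mprod (h i) (h k) != 0 /\ mprod (h j) (h l) != 0.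
  have imp1 : mprod (h i) (h k) != 0 -> mprod (h j) (h l) != 0.
    by move=> nik; apply: (@dual_face_diagonal_neq0 _ (h i) (h j) (h k) (h l)
      (x l - x j) (x k - x i) c1 c2 c2').
  have imp2 : mprod (h j) (h l) != 0 -> mprod (h k) (h i) != 0.
    move=> njl; apply: (@dual_face_diagonal_neq0 _ (h j) (h k) (h l) (h i)
      (x i - x k) (x l - x j) c2 (s k l / mprod (h k) (h l)) c1) => //.
    - by rewrite -xjk -xkl [RHS]addrC addrA subrK.
    - by rewrite -(opprB (x k)) xki opprD -scalerN opprB.
    - by rewrite -opprB oppr_eq0.
    - by rewrite -(opprB (h i)) -(scaleN1r (h i - h k)) wedgeZr w2' scaler0.
  have [ik0|nik] := eqVneq (mprod (h i) (h k)) 0; last by split=> //; apply: imp1.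
  have [jl0|njl] := eqVneq (mprod (h j) (h l)) 0; last first.
    by have := imp2 njl; rewrite mprodC ik0 eqxx.
  have hkE : h k \in <[h i]>%VS.
    rewrite (null_orthogonal_parallel (hh k) (hh i) _ (h0 i)) ?memvZ ?memv_line //.
    by rewrite mprodC.
  have hlE : h l \in <[h j]>%VS.
    rewrite (null_orthogonal_parallel (hh l) (hh j) _ (h0 j)) ?memvZ ?memv_line //.
    by rewrite mprodC.
  have sub : (G i + G j + G k + G l <= <<[:: h i; h j]>>)%VS.
    have hi_in : h i \in <<[:: h i; h j]>>%VS by rewrite memv_span ?inE ?eqxx.
    have hj_in : h j \in <<[:: h i; h j]>>%VS by rewrite memv_span ?inE ?eqxx ?orbT.
    rewrite !subv_add !GE -!memvE hi_in hj_in.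
    by rewrite (subvP _ _ hkE) ?(subvP _ _ hlE) // -memvE.
  have := leq_trans (dim3 _ _ _ _ f) (leq_trans (dimvS sub) (dim_span _)).
  by [].
have [t xt] := wedge_eq0_parallel w1' xik0.
have t0 : t != 0.
  apply: contraNneq njl => t0; move: xt; rewrite t0 scale0r => /eqP.
  by rewrite subr_eq0 => /eqP ->; rewrite hh.
have [t' xt'] := wedge_eq0_parallel w2' xjl0.
have t0' : t' != 0.
  apply: contraNneq nik => t0'; move: xt'; rewrite t0' scale0r => /eqP.
  by rewrite subr_eq0 => /eqP ->; rewrite hh.
have r1 : x k - x i = t^-1 *: (h j - h l) by rewrite xt scalerK.
have r2 : x l - x j = t'^-1 *: (h i - h k) by rewrite xt' scalerK.
have [] := @dual_face_gram _ (h i) (h j) (h k) (h l) c1 c2 c1' c2' t^-1 t'^-1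
  (hh i) (hh j) (hh k) (hh l) nij nik nil njk njl nkl c10 c20 c10' c20'.
- by rewrite -xki.
- by rewrite -xki'.
- by rewrite -xlj.
rewrite (mprodC (h k)) !(divfK nij) !(divfK njk) !(divfK nlk) !(divfK nil) => e1 e2 g1 g2.
rewrite e2 in g1 g2; split=> //.
(* For equal labels the product in [label_signs] would be a square. *)
split; rewrite ?snz //; apply/eqP => e0; have := sg _ _ _ _ f.
by rewrite -e0 -expr2 ltNge sqr_ge0.
Qed.

End Pairs.

(** * From a pair of surfaces to the holomorphic data *)

Section Converse.

Variable R : realType.
Notation C := R[i].
Implicit Types (x h g : Z2 -> mink R) (G : Z2 -> {vspace mink R}).

Lemma Z2_connected (P : Z2 -> Prop) : P (0, 0) ->
  (forall i j, edge i j -> P i -> P j) -> forall i, P i.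
Proof.
move=> P0 step.
have row : forall a : int, P (a, 0).
  elim/int_rect => [//|n IH|n IH].
    by apply: step IH; rewrite /edge /=; lia.
  by apply: step IH; rewrite /edge /=; lia.
case=> a b; elim/int_rect: b => [//|n IH|n IH].
  by apply: step IH; rewrite /edge /=; lia.
by apply: step IH; rewrite /edge /=; lia.
Qed.

(** The matrix has determinant 0; multiplied by a nonzero diagonal entry it becomes [u u^*], with u
    the column of that entry. The factor [k] also absorbs the sign of a past-directed vector. *)
Lemma null_spinor (y : mink R) : mprod y y = 0 -> y != 0 ->
  exists (k : R) (v : 'cV[C]_2), k != 0 /\ herm (k *: y) = spinor_mx v.
Proof.
move=> yy y0; set p := y 0 0 + y 0 3%:R; set q := y 0 0 - y 0 3%:R.
set z : C := y 0 1 +i* y 0 2%:R.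
have yE : herm y = mx2 p%:C z (Num.conj z) q%:C by [].
have zz : z * Num.conj z = p%:C * q%:C.
  apply/eqP; rewrite eq_complex /= /p /q; apply/andP; split; apply/eqP; last ring.
  by move: yy; rewrite mprodE; lra.
have [q0|q0] := eqVneq q 0; last first.
  exists q, (spinor z q%:C); split=> //; rewrite hermZ yE.
  apply: mx2_eqP; rewrite [LHS]mxE !mx2_entries !mxE /=.
  - by rewrite zz mulrC.
  - by rewrite conj_real mulrC.
  - by [].
  - by rewrite conj_real.
have z0 : z = 0 by apply/eqP; rewrite -mul_conj_eq0 zz q0 mulr0.
have p0 : p != 0.
  apply: contraNneq y0 => p0; apply/eqP/herm_inj.
  rewrite yE p0 z0 q0; apply: mx2_eqP; rewrite !mx2_entries !mxE ?conj0 //; apply/eqP;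
    by rewrite eq_complex /= ?addr0 ?subr0 ?oppr0 ?eqxx.
exists p, (spinor p%:C 0); split=> //; rewrite hermZ yE.
apply: mx2_eqP; rewrite [LHS]mxE !mx2_entries !mxE /=.
- by rewrite conj_real.
- by rewrite z0 !(rmorph0, mulr0).
- by rewrite z0 !(rmorph0, mulr0, mul0r).
- by rewrite q0 !(rmorph0, mulr0, mul0r).
Qed.

Lemma herm_congruent mu (y : mink R) : mprod y y = mu -> y != 0 ->
  exists (e : R) (P : 'M[C]_2), [/\ e = 1 \/ e = -1, 0 < mu -> e = 1, \det P = 1 &
    herm y = e%:C *: (P *m mx2 1 0 0 (- mu%:C) *m adjoint P)].
Proof.
move=> yy y0; set p := y 0 0 + y 0 3%:R; set q := y 0 0 - y 0 3%:R.
set z : C := y 0 1 +i* y 0 2%:R.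
have yE : herm y = hmx p q z by [].
have zz : z * Num.conj z = mu%:C + p%:C * q%:C.
  apply/eqP; rewrite eq_complex /= /p /q -yy mprodE; apply/andP; split; apply/eqP; ring.
have hm0 : hmx p q z != 0.
  rewrite -yE; apply: contraNneq y0 => e0; apply/eqP/herm_inj.
  by rewrite e0 -(scale0r y) hermZ rmorph0 scale0r.
have [e [he mue [P dP PE]]] := congruent_up_to_sign_hmx zz hm0.
exists e, P; split=> //; rewrite -PE yE scalerA -rmorphM.
by case: he => ->; rewrite ?mulrNN mulr1 rmorph1 scale1r.
Qed.

(* A rotation in the stabilizer of [diag (1, - mu)]; it moves all the points
   of a countable set away from infinity. *)
Lemma stabilizer_avoiding (mu : R) (a : Z2 -> 'cV[C]_2) :
  (forall i, a i 1 0 * Num.conj (a i 1 0) != mu%:C * (a i 0 0 * Num.conj (a i 0 0))) ->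
  exists2 U : 'M[C]_2, \det U = 1 /\
    U *m mx2 1 0 0 (- mu%:C) *m adjoint U = mx2 1 0 0 (- mu%:C) &
    forall i, (invmx U *m a i) 1 0 != 0.
Proof.
move=> a_ne.
(* Up to a nonzero factor the second entry of U^-1 a_i is a_i1 - mu y a_i0, so this quotient is the
   only value of y that vertex i forbids. Codes of no vertex receive the harmless value 0. *)
pose f n : R := if unpickle n is Some i then
  complex.Re (a i 1 0 / (mu%:C * a i 0 0)) else 0.
(* Below this bound both y and |mu| y are less than 1, so 1 - mu y^2 is positive and has a real
   square root. *)
have e0 : 0 < (1 + `|mu|)^-1 by rewrite invr_gt0 ltr_wpDr.
have [y [y0 ye yf]] := exists_avoiding f e0.
have muy : 0 < 1 - mu * y ^+ 2.
  have h1 : y * (1 + `|mu|) < 1 by rewrite -ltr_pdivlMr ?mul1r // ltr_wpDr.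
  have h2 := ler_norm mu; have h3 := normr_ge0 mu.
  have h4 : mu * y <= `|mu| * y by rewrite ler_pM2r.
  have h5 : 0 <= `|mu| * y by rewrite mulr_ge0 // ltW.
  have h6 : y < 1 by nra.
  rewrite subr_gt0 expr2 mulrA; nra.
set s := Num.sqrt (1 - mu * y ^+ 2).
have s0 : s%:C != 0 :> C by rewrite fmorph_eq0 sqrtr_eq0 -ltNge.
have ss : s%:C ^+ 2 = 1 - mu%:C * y%:C ^+ 2 :> C.
  by rewrite -rmorphXn sqr_sqrtr ?ltW // rmorphB rmorph1 rmorphM rmorphXn.
have D0 : 1 - mu%:C * y%:C ^+ 2 != 0 :> C by rewrite -ss expf_neq0.
pose U := mx2 s%:C^-1 (y%:C / s%:C) (mu%:C * y%:C / s%:C) s%:C^-1 : 'M[C]_2.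
pose V := mx2 s%:C^-1 (- (y%:C / s%:C)) (- (mu%:C * y%:C / s%:C)) s%:C^-1 : 'M[C]_2.
have dU : \det U = 1.
  rewrite det_mx2E !mx2_entries; transitivity ((1 - mu%:C * y%:C ^+ 2) / s%:C ^+ 2).
    by field.
  by rewrite ss divff.
have VU : V *m U = 1%:M.
  have sV : s%:C^-1 ^+ 2 = (1 - mu%:C * y%:C ^+ 2)^-1 :> C by rewrite exprVn ss.
  apply: mx2_eqP; rewrite mulmx2E !mx2_entries mxE /=.
  - transitivity (s%:C^-1 ^+ 2 * (1 - mu%:C * y%:C ^+ 2)); first by ring.
    by rewrite sV mulVf.
  - by ring.
  - by ring.
  - transitivity (s%:C^-1 ^+ 2 * (1 - mu%:C * y%:C ^+ 2)); first by ring.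
    by rewrite sV mulVf.
have uU : U \in unitmx by rewrite unitmxE dU unitr1.
have iU : invmx U = V by rewrite -[V]mulmx1 -(mulmxV uU) mulmxA VU mul1mx.
exists U.
  split=> //.
  have sV : s%:C^-1 ^+ 2 = (1 - mu%:C * y%:C ^+ 2)^-1 :> C by rewrite exprVn ss.
  have cs : Num.conj s%:C = s%:C :> C := conj_real s.
  have cy : Num.conj y%:C = y%:C :> C := conj_real y.
  have cmu : Num.conj mu%:C = mu%:C :> C := conj_real mu.
  apply: mx2_eqP; rewrite !mulmx2E !adjointE !mx2_entries ?(rmorphM, fmorphV) /= ?cs ?cy ?cmu.
  - transitivity (s%:C^-1 ^+ 2 * (1 - mu%:C * y%:C ^+ 2)); first by ring.
    by rewrite sV mulVf.
  - by ring.
  - by ring.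
  - transitivity (- mu%:C * (s%:C^-1 ^+ 2 * (1 - mu%:C * y%:C ^+ 2))); first by ring.
    by rewrite sV mulVf ?mulr1.
move=> i; rewrite iU mulmx2E !mx2_entries; apply/eqP => E.
have E' : a i 1 0 = mu%:C * y%:C * a i 0 0.
  apply/eqP; rewrite -subr_eq0; apply/eqP.
  transitivity (s%:C * (- (mu%:C * y%:C / s%:C) * a i 0 0 + s%:C^-1 * a i 1 0)).
    by field.
  by rewrite E mulr0.
have [m0|m0] := eqVneq (mu%:C * a i 0 0) 0.
  have b0 : a i 1 0 = 0 by rewrite E' mulrAC m0 mul0r.
  by have := a_ne i; rewrite b0 mul0r mulrA m0 mul0r eqxx.
have := yf (pickle i); rewrite /f pickleK E'.
have -> : mu%:C * y%:C * a i 0 0 / (mu%:C * a i 0 0) = y%:C.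
  transitivity (y%:C * (mu%:C * a i 0 0 / (mu%:C * a i 0 0))); first by ring.
  by rewrite divff ?mulr1.
by rewrite eqxx.
Qed.

End Converse.

Lemma mulmx_congl (F : fieldType) (A B1 B2 B3 B4 : 'M[F]_2) :
  B1 *m B2 = B3 *m B4 -> B1 *m (B2 *m A) = B3 *m (B4 *m A).
Proof. by move=> e; rewrite mulmxA e -mulmxA. Qed.

Lemma congruence_scale (F : fieldType) (a b : F) (A B D E U : 'M[F]_2) :
  a *: (A *m (b *: (B *m D *m E)) *m U) = (a * b) *: (A *m B *m D *m (E *m U)).
Proof. by rewrite -scalemxAr -scalemxAl scalerA !mulmxA. Qed.

Lemma bil_diag_outer (F : fieldType) (p : F) (y z : 'cV[F]_2) :
  bil (mx2 1 0 0 p) (outer y z) = y 1 0 * z 1 0 + p * (y 0 0 * z 0 0).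
Proof. by rewrite /bil !mx2_entries; ring. Qed.

(** Each of the four scales of the spinors occurs once on either side of a cross-ratio equation and
    cancels. *)
Lemma cross_ratio_cancel (F : fieldType) (s1 s2 w1 w2 ci cj cp cl a b d e : F) :
  ci != 0 -> cj != 0 -> cp != 0 -> cl != 0 -> w1 != 0 -> s2 != 0 -> d != 0 -> e != 0 ->
  s2 * (ci * (cj * w1) * a * (cp * (cl * w1) * b)) =
    s1 * (cj * (cp * w2) * d * (cl * (ci * w2) * e)) ->
  a / d * (b / e) = s1 * w2 ^+ 2 / (s2 * w1 ^+ 2).
Proof.
move=> ci0 cj0 cp0 cl0 w10 s20 d0 e0 cr.
have c0 : ci * cj * cp * cl != 0 by rewrite !mulf_neq0.
have E : s2 * w1 ^+ 2 * (a * b) = s1 * w2 ^+ 2 * (d * e).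
  apply: (mulfI c0).
  transitivity (s2 * (ci * (cj * w1) * a * (cp * (cl * w1) * b))); first by ring.
  by rewrite cr; ring.
transitivity (s2 * w1 ^+ 2 * (a * b) / (s2 * w1 ^+ 2 * (d * e))).
  by field; rewrite d0 e0 w10 s20.
by rewrite E; field; rewrite d0 e0 w10 s20.
Qed.

(** * Parallel frames and holomorphic data of a dual net *)

Section Frame.

Variables (R : realType) (mu : R) (x h : Z2 -> mink R) (s : Z2 -> Z2 -> R).
Notation C := R[i].
Hypotheses (net : dual_net mu x h s) (signs : label_signs s).
Variables (k : Z2 -> R) (v : Z2 -> 'cV[C]_2).
Hypothesis kv : forall i, k i != 0 /\ herm (k i *: h i) = spinor_mx (v i).

Let g i := k i *: h i.
Let t i j := 1 - s i j.
(** The scale is normalized to m = 1, so that m_ij + 1 = 1/s_ij and t_ij = m_ij/(m_ij + 1). *)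
Let ml i j := t i j / s i j.
Let r i j : C := sqrtC (ml i j)%:C.
Let r' i j : C := sqrtC (ml i j + 1)%:C.
Let w i j := r i j / r' i j.
Let sgn i j : R := Num.sg (t i j).

Let gv i : herm (g i) = spinor_mx (v i) := (kv i).2.

Let s0 i j : edge i j -> s i j != 0.
Proof.
by move=> /edge_face [p [l f]]; have [_ _ fc] := net; have [_ []] := fc _ _ _ _ f.
Qed.

Let t0 i j : edge i j -> t i j != 0.
Proof.
move=> /edge_face [p [l /signs]]; apply: contraTneq; rewrite /t => ->.
by rewrite !mul0r ltxx.
Qed.

Let ssym i j : edge i j -> s i j = s j i.
Proof. by have [_ ed _] := net => /ed []. Qed.

Let ml1 i j : edge i j -> ml i j + 1 = (s i j)^-1.
Proof. by move=> /s0 ?; rewrite /ml /t; field. Qed.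

(** The roots are principal ones of functions of s, so they inherit the symmetry of s and its
    equality on opposite edges. *)
Let wE i j i' j' : s i j = s i' j' -> w i j = w i' j'.
Proof. by move=> e; rewrite /w /r /r' /ml /t e. Qed.

Let w2 i j : edge i j -> w i j ^+ 2 = (t i j)%:C.
Proof.
move=> ij; rewrite exprMn exprVn !sqrtCK ml1 // -fmorphV invrK -rmorphM.
by rewrite /ml divfK ?s0.
Qed.

Let w0 i j : edge i j -> w i j != 0.
Proof. by move=> ij; rewrite -sqrf_eq0 w2 // fmorph_eq0 t0. Qed.

Let sgn2 i j : edge i j -> sgn i j ^+ 2 = 1.
Proof. by move=> ij; rewrite sqr_sg t0. Qed.

Let wc i j : edge i j -> Num.conj (w i j) = (sgn i j)%:C * w i j.
Proof.
move=> ij; apply: conj_sqrt_real (w2 ij) (sgn2 ij) _.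
by rewrite /sgn -normrEsg normr_gt0 t0.
Qed.

Let hprod i j : edge i j -> mprod (g i) (g j) != 0.
Proof.
have [_ ed _] := net => /ed [hh _ _]; have [[ki _] [kj _]] := (kv i, kv j).
by rewrite !mprod_lin !mulf_neq0.
Qed.

Let d0 i j : edge i j -> dt (v i) (v j) != 0.
Proof. by move=> ij; rewrite -(mprod_spinors_neq0 (gv i) (gv j)) hprod. Qed.

Let cross_ratio i j p l : face i j p l ->
  (s i l)%:C * (dt (v i) (v j) * dt (v p) (v l)) =
  (s i j)%:C * (dt (v j) (v p) * dt (v l) (v i)).
Proof.
move=> f; have [_ _ fc] := net; have [_ [s1 s2 _] g1 g2] := fc _ _ _ _ f.
apply: (gram_cross_ratio _ (gv i) (gv j) (gv p) (gv l) s2).2.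
rewrite /g !mprod_lin; split.
  transitivity (k i * k j * k p * k l *
    (mprod (h i) (h j) * mprod (h p) (h l) * s i l ^+ 2)); first by ring.
  by rewrite g1; ring.
transitivity (k i * k j * k p * k l *
    (mprod (h i) (h p) * mprod (h j) (h l) * s i l ^+ 2)); first by ring.
by rewrite g2; ring.
Qed.

Let xg i : mprod (x i) (g i) = k i.
Proof. by have [vert _ _] := net; have [_ xh _] := vert i; rewrite mprodZr xh mulr1. Qed.

Let gh i : (mprod (x i) (g i))^-1 *: g i = h i.
Proof. by rewrite xg scalerK //; have [] := kv i. Qed.

Let boost_x i j : edge i j ->
  boost (w i j) (v i) (v j) *m herm (x i) *m adjoint (boost (w i j) (v i) (v j)) =
  (sgn i j)%:C *: herm (x j).
Proof.
move=> ij; rewrite (boost_herm (x i) (w0 ij) (d0 ij) (w2 ij) (wc ij) (sgn2 ij) (gv i) (gv j)).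
congr (_ *: herm _); have [vert ed _] := net; have [hij _ xij] := ed _ _ ij.
have [[hi xi _] [hj xj _]] := (vert i, vert j).
have nz p : mprod (x p) (g p) != 0 by rewrite xg; have [] := kv p.
have xgt : mprod (x i) (g j) = t i j * mprod (x j) (g j).
  rewrite xg mprodZr mulrC; congr (_ * _).
  by rewrite -[x i](subKr (x j)) xij !mprod_lin xj hj subr0 divfK.
by rewrite (edge_step (t0 ij) (hprod ij) (nz i) (nz j) xgt) !gh /t subKr -xij addrC subrK.
Qed.

Let frame_step i j (A : 'M[C]_2 * R) : 'M[C]_2 * R :=
  (boost (w i j) (v i) (v j) *m A.1, sgn i j * A.2).

(** Frame and sign are integrated together. The frame is flat by [boost_flat], the signs because s
    agrees on opposite edges. The normal form of x, arranged at the origin, is carried along the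
    edges by [boost_x]. *)
Lemma frame_exists : exists (Phi : Z2 -> 'M[C]_2) (e : Z2 -> R),
  [/\ 0 < mu -> e (0, 0) = 1,
    forall i j, edge i j -> Phi j = boost (w i j) (v i) (v j) *m Phi i,
    forall i j, edge i j -> e j = sgn i j * e i &
    forall i, [/\ \det (Phi i) = 1, e i = 1 \/ e i = -1 &
      herm (x i) = (e i)%:C *: (Phi i *m mx2 1 0 0 (- mu%:C) *m adjoint (Phi i))]].
Proof.
have [vert ed fc] := net.
have [_ xh0 xx0] := vert (0, 0).
have x0 : x (0, 0) != 0 by apply: (mprod_neq0l (b := h (0, 0))); rewrite xh0 oner_eq0.
have [e0 [P0 [he0 mue0 dP0 xP0]]] := herm_congruent xx0 x0.
have [||f [f0 fS]] := @Z2_integrable _ frame_step (P0, e0).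
- move=> i j [A a] ij; have ji : edge j i by rewrite edgeC.
  rewrite /frame_step /= mulmxA (wE (ssym ji)) (boost_inv (w0 ij) (d0 ij)) mul1mx.
  have -> : sgn j i = sgn i j by rewrite /sgn /t ssym.
  by rewrite mulrA -expr2 sgn2 // mul1r.
- move=> i j p l [A a] fa; have [ij jp pl li] := faceP fa.
  have il : edge i l by rewrite edgeC.
  have [[e1 e2] _ _ _] := fc _ _ _ _ fa.
  have flat : boost (w j p) (v j) (v p) *m boost (w i j) (v i) (v j) =
      boost (w l p) (v l) (v p) *m boost (w i l) (v i) (v l).
    have -> : w j p = w i l by apply/esym/wE.
    have -> : w l p = w i j by apply/esym/wE.
    apply: boost_flat (w0 ij) (w0 il) (d0 ij) (d0 jp) (d0 pl) (d0 li) _.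
    rewrite (w2 il) (w2 ij) /t !rmorphB rmorph1 !subKr.
    exact: cross_ratio.
  apply: injective_projections.
    exact (mulmx_congl A flat).
  change (sgn j p * (sgn i j * a) = sgn l p * (sgn i l * a)).
  have -> : sgn j p = sgn i l by rewrite /sgn /t e2.
  have -> : sgn l p = sgn i j by rewrite /sgn /t e1.
  by rewrite mulrCA.
exists (fun i => (f i).1), (fun i => (f i).2).
have eq1 i j : edge i j -> (f j).1 = boost (w i j) (v i) (v j) *m (f i).1.
  by move=> ij; rewrite (fS _ _ ij).
have eq2 i j : edge i j -> (f j).2 = sgn i j * (f i).2.
  by move=> ij; rewrite (fS _ _ ij).
split; [by rewrite f0|exact: eq1|exact: eq2|].
apply: Z2_connected; first by rewrite f0.
move=> i j ij [di ei xi]; rewrite (eq1 _ _ ij) (eq2 _ _ ij); split.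
- by rewrite det_mulmx (det_boost (w0 ij) (d0 ij)) mul1r.
- rewrite /sgn; case: sgrP (t0 ij) => [_ /eqP //|_ _|_ _]; rewrite ?mul1r ?mulN1r //.
  by case: ei => ->; [right|left; rewrite opprK].
have sC : (sgn i j)%:C * (sgn i j)%:C = 1 :> C by rewrite -rmorphM -expr2 sgn2.
have := boost_x ij; rewrite xi.
move=> /(congr1 (fun B => (sgn i j)%:C *: B)).
rewrite [(sgn i j)%:C *: (_ *: herm _)]scalerA sC scale1r => <-.
rewrite adjointM rmorphM.
exact: congruence_scale.
Qed.

(** In the frame, psi_i is the quotient of the components of the spinor v_i. Right multiplication by
    an element of the stabilizer of diag(1, -mu) changes neither x nor the transition matrices and
    makes all second components nonzero. The hypothesis of [stabilizer_avoiding] holds since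
    (x_i,g_i) = k_i != 0. *)
Lemma dual_net_gauge : exists (Psi : Z2 -> 'M[C]_2) (e : Z2 -> R) (psi c : Z2 -> C),
  [/\ [/\ 0 < mu -> e (0, 0) = 1, forall i, e i = 1 \/ e i = -1 &
      forall i j, edge i j -> e j = sgn i j * e i],
    forall i, \det (Psi i) = 1,
    forall i j, edge i j -> Psi j = boost (w i j) (v i) (v j) *m Psi i,
    forall i, herm (x i) = (e i)%:C *: (Psi i *m mx2 1 0 0 (- mu%:C) *m adjoint (Psi i)) &
    forall i, c i != 0 /\ v i = c i *: (Psi i *m spinor (psi i) 1)].
Proof.
have [Phi [e [mue PhiB es PhiE]]] := frame_exists.
have dPhi i : \det (Phi i) = 1 by have [] := PhiE i.
have uPhi i : Phi i \in unitmx by rewrite unitmxE dPhi unitr1.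
pose a i := invmx (Phi i) *m v i.
have va i : v i = Phi i *m a i by rewrite mulKVmx.
clearbody a.
have [|U [dU UQ] Ua] := @stabilizer_avoiding R mu a.
  move=> i; apply/eqP => bad; have [/eqP k0 _] := kv i; apply: k0.
  rewrite -xg; apply: complexI; rewrite mprod_bil gv va spinor_mx_mul.
  have [_ _ ->] := PhiE i.
  have bilZ (z : C) (A B : 'M[C]_2) : bil (z *: A) B = z * bil A B.
    by rewrite /bil !mxE; ring.
  rewrite bilZ bil_adjoint dPhi rmorph1 !mul1r.
  have -> : bil (mx2 1 0 0 (- mu%:C)) (spinor_mx (a i)) = 0.
    by rewrite bil_diag_outer !mxE bad mulNr subrr.
  by rewrite !mulr0.
have uU : U \in unitmx by rewrite unitmxE dU unitr1.
pose y i := invmx U *m a i.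
have ay i : a i = U *m y i by rewrite mulKVmx.
have y0 i : y i 1 0 != 0 := Ua i.
clearbody y.
exists (fun i => Phi i *m U), e, (fun i => y i 0 0 / y i 1 0), (fun i => y i 1 0).
split.
- by split=> // i; have [] := PhiE i.
- by move=> i; rewrite det_mulmx dPhi dU mulr1.
- by move=> i j ij; rewrite (PhiB _ _ ij) mulmxA.
- move=> i; have [_ _ ->] := PhiE i; congr (_ *: _).
  by rewrite -[in LHS]UQ adjointM !mulmxA.
move=> i; split=> //; rewrite va ay -mulmxA scalemxAr scalemxAr.
congr (_ *m (_ *m _)); apply: spinor_eqP; rewrite !mxE /=; last by rewrite mulr1.
by rewrite mulrC divfK.
Qed.

Lemma dual_net_weierstrass (xp xm : Z2 -> mink R) (G : Z2 -> {vspace mink R}) :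
  (forall p, G p = <[h p]>%VS) ->
  (forall p, xp p = x p - ((mu + 1) / 2%:R) *: h p) ->
  (forall p, xm p = x p - ((mu - 1) / 2%:R) *: h p) ->
  exists (m : R) (psi : Z2 -> C) (ml : Z2 -> Z2 -> R) (r r' : Z2 -> Z2 -> C)
    (Psi : Z2 -> 'M[C]_2) (e : Z2 -> R),
    [/\ weierstrass_data mu m psi ml r r' Psi e, 0 < mu -> e (0, 0) = 1,
        weierstrass_surface mu 1 psi Psi e xp,
        weierstrass_surface mu (-1) psi Psi e xm & weierstrass_gauss psi Psi G].
Proof.
move=> GE xpE xmE; have [vert ed fc] := net.
have [Psi [e [psi [c [[mue e1 es] dPsi PsiB PsiE cv]]]]] := dual_net_gauge.
(* The boost sends [Psi i] to [Psi j], hence z to v_j / c_j; its inverse has eigenvalue 1/w_ij on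
   v_j. *)
have vj i j : edge i j -> v j = (c j * w i j) *: (Psi i *m spinor (psi j) 1).
  move=> ij; have [cj vE] := cv j.
  set z := Psi i *m _.
  have bz : boost (w i j) (v i) (v j) *m z = (c j)^-1 *: v j.
    by rewrite /z mulmxA -(PsiB _ _ ij) [in RHS]vE scalerK.
  have zE : z = (c j)^-1 *: ((w i j)^-1 *: v j).
    rewrite -(boost_fst (w i j) (v j) (v i)) scalemxAr -bz mulmxA.
    by rewrite (boost_inv (w0 ij) (d0 ij)) mul1mx.
  by rewrite zE !scalerA -mulrA (mulrCA (w i j)) (mulfV (w0 ij)) mulr1 (mulfV cj) scale1r.
have dtv i j : edge i j -> dt (v i) (v j) = c i * (c j * w i j) * (psi i - psi j).
  move=> ij; rewrite (vj _ _ ij) dtZr (cv i).2 dtZl dt_mul dPsi dt_spinor mul1r.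
  by ring.
have psi_neq i j : edge i j -> psi i != psi j.
  move=> ij; have := d0 ij; rewrite (dtv _ _ ij); apply: contraNneq => ->.
  by rewrite subrr mulr0.
have rE i j : r i j ^+ 2 = (ml i j)%:C := sqrtCK _.
have rE' i j : r' i j ^+ 2 = (ml i j + 1)%:C := sqrtCK _.
have ml0 i j : edge i j -> ml i j != 0.
  by move=> ij; rewrite mulf_neq0 ?t0 // invr_neq0 ?s0.
have ml10 i j : edge i j -> ml i j + 1 != 0.
  by move=> ij; rewrite ml1 // invr_neq0 ?s0.
have r0 i j : edge i j -> r i j != 0.
  by move=> ij; rewrite -sqrf_eq0 rE fmorph_eq0 ml0.
have r0' i j : edge i j -> r' i j != 0.
  by move=> ij; rewrite -sqrf_eq0 rE' fmorph_eq0 ml10.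
have mlE i j i' j' : s i j = s i' j' -> ml i j = ml i' j'.
  by move=> E; rewrite /ml /t E.
have rs i j i' j' : s i j = s i' j' -> r i j = r i' j' by move=> /mlE E; rewrite /r E.
have rs' i j i' j' : s i j = s i' j' -> r' i j = r' i' j' by move=> /mlE E; rewrite /r' E.
have /choice [n nE] : forall i, exists n : R, `|c i| ^+ 2 = n%:C.
  by move=> i; apply: normc_sqr.
have n0 i : n i != 0.
  by rewrite -(fmorph_eq0 (real_complex R)) /= -nE expf_neq0 // normr_eq0; have [] := cv i.
pose g' i := (n i)^-1 *: g i.
have gE' i : herm (g' i) = Psi i *m Nmx (psi i) *m adjoint (Psi i).
  have [ci vE] := cv i.
  have nC : (n i)%:C != 0 :> C by rewrite fmorph_eq0.
  rewrite hermZ gv vE spinor_mxZ -normCK nE scalerA -rmorphM mulVf // rmorph1 scale1r.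
  by rewrite Nmx_spinor spinor_mx_mul.
have xg' i : mprod (x i) (g' i) = (n i)^-1 * k i by rewrite mprodZr xg.
have xg0 i : mprod (x i) (g' i) != 0.
  by rewrite xg' mulf_neq0 ?invr_neq0 //; have [] := kv i.
have hE i : (mprod (x i) (g' i))^-1 *: g' i = h i.
  rewrite xg' scalerA -[RHS](gh i) xg; congr (_ *: _).
  have ki : k i != 0 by have [] := kv i.
  by have ni := n0 i; field; rewrite ki ni.
have ee2 i : e i ^+ 2 = 1 by case: (e1 i) => ->; rewrite ?sqrrN expr1n.
have mupsi i : mu%:C * `|psi i| ^+ 2 != 1.
  have [xgE _] := vertex_products (ee2 i) (dPsi i) (PsiE i) (gE' i).
  apply: contraNneq (xg0 i) => E; apply/eqP/complexI.
  by rewrite xgE E subrr !mulr0.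
have D0 i : 1 - mu%:C * `|psi i| ^+ 2 != 0 by rewrite subr_eq0 eq_sym mupsi.
exists 1, psi, ml, r, r', Psi, e; split.
- split.
  + split=> [i j ij|i j p l f].
      by split; [apply: mlE; apply: ssym | apply: ml0].
    have [[e12 e21] [s1 s2 s12] _ _] := fc _ _ _ _ f.
    have [ij jp pl li] := faceP f; have il : edge i l by rewrite edgeC.
    have lp : edge l p by rewrite edgeC.
    split; [exact: mlE|exact: mlE| |].
      have [[ci _] [cj _]] := (cv i, cv j); have [[cp _] [cl _]] := (cv p, cv l).
      have wpl : w p l = w i j by apply: wE; rewrite (ssym pl).
      have wjp : w j p = w i l by apply: wE; rewrite e21.
      have wli : w l i = w i l := wE (ssym li).
      have cr := cross_ratio f.
      rewrite (dtv _ _ ij) (dtv _ _ pl) (dtv _ _ jp) (dtv _ _ li) wpl wjp wli in cr.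
      have jp0 : psi j - psi p != 0 by rewrite subr_eq0 psi_neq.
      have li0 : psi l - psi i != 0 by rewrite subr_eq0 psi_neq.
      have -> : (ml i l / ml i j)%:C = ((s i j)%:C * w i l ^+ 2) / ((s i l)%:C * w i j ^+ 2).
        rewrite (w2 il) (w2 ij) -!rmorphM -fmorphV -rmorphM; congr (_%:C).
        by rewrite /ml; field; rewrite s1 s2 (t0 ij).
      have s2C : (s i l)%:C != 0 :> C by rewrite fmorph_eq0.
      exact: (cross_ratio_cancel ci cj cp cl (w0 ij) s2C jp0 li0 cr).
    have := signs f; rewrite -!/(t _ _) => neg.
    have -> : ml i l / ml i j = (t i j * s i j) * (t i l * s i l) / (t i j * s i l) ^+ 2.
      by rewrite /ml; field; rewrite s1 s2 (t0 ij).
    by rewrite pmulr_llt0 // invr_gt0 lt0r sqr_ge0 andbT expf_neq0 // mulf_neq0 ?t0.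
  + split; first exact: oner_neq0.
    exact: ml10.
  + split; split=> [i j ij|i j p l f].
    * by split; [apply/rs/ssym | exact: rE].
    * by have [[? ?] _ _ _] := fc _ _ _ _ f; split; apply: rs.
    * by split; [apply/rs'/ssym | exact: rE'].
    * by have [[? ?] _ _ _] := fc _ _ _ _ f; split; apply: rs'.
  + split=> [|i j ij]; first exact: dPsi.
    rewrite (Bmx_boost (psi_neq _ _ ij) (r0 _ _ ij) (r0' _ _ ij) (rE i j) (rE' i j)).
    have dP : \det (Psi i) != 0 by rewrite dPsi oner_eq0.
    have dsp : dt (spinor (psi i) 1) (spinor (psi j) 1) != 0.
      by rewrite dt_spinor subr_eq0 psi_neq.
    have dPsp : dt (Psi i *m spinor (psi i) 1) (Psi i *m spinor (psi j) 1) != 0.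
      by rewrite dt_mul mulf_neq0.
    have cw : c j * w i j != 0 by rewrite mulf_neq0 ?w0 //; have [] := cv j.
    rewrite -(boost_conj (w0 ij) dsp dP) -(boostZ (w0 ij) (proj1 (cv i)) cw dPsp).
    by rewrite -(vj _ _ ij) -(cv i).2; apply: PsiB.
  + split; [exact: mupsi|split=> [|i j ij]; first exact: e1].
    rewrite (es _ _ ij).
    have -> : e i * (sgn i j * e i) * (ml i j * (ml i j + 1)) =
        e i ^+ 2 * ((sgn i j * t i j) * (s i j)^-1 ^+ 2).
      by rewrite (ml1 ij) /ml; field; rewrite s0.
    rewrite ee2 mul1r /sgn -normrEsg mulr_gt0 ?normr_gt0 ?t0 //.
    by rewrite lt0r sqr_ge0 andbT expf_neq0 // invr_neq0 // s0.
- exact: mue.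
- move=> i; rewrite xpE -hE.
  exact: (vertex_surface 1 (ee2 i) (dPsi i) (D0 i) (PsiE i) (gE' i)).
- move=> i; rewrite xmE -hE.
  exact: (vertex_surface (-1) (ee2 i) (dPsi i) (D0 i) (PsiE i) (gE' i)).
move=> i; exists (g' i); last exact: gE'.
rewrite GE /g' /g !vline_scale ?invr_neq0 //.
by have [] := kv i.
Qed.

End Frame.

Unset Implicit Arguments.

Theorem theorem4p11 (R : realType) (mu : R) :
  (forall (m : R) (psi : Z2 -> R[i]) (ml : Z2 -> Z2 -> R)
      (r r' : Z2 -> Z2 -> R[i]) (Psi : Z2 -> 'M[R[i]]_2) (e : Z2 -> R)
      (xp xm : Z2 -> mink R) (G : Z2 -> {vspace mink R}),
    weierstrass_data mu m psi ml r r' Psi e ->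
    weierstrass_surface mu 1 psi Psi e xp ->
    weierstrass_surface mu (-1) psi Psi e xm ->
    weierstrass_gauss psi Psi G ->
    regular xp ->
    regular xm ->
    (forall g, is_lift g G -> regular (middle_section mu 1 xp g)) ->
    BrLW_BiLW_pair mu xp xm G)
  /\
  (forall (xp xm : Z2 -> mink R) (G : Z2 -> {vspace mink R}),
    BrLW_BiLW_pair mu xp xm G ->
    opposite_labels mu xp G <->
    exists (m : R) (psi : Z2 -> R[i]) (ml : Z2 -> Z2 -> R)
      (r r' : Z2 -> Z2 -> R[i]) (Psi : Z2 -> 'M[R[i]]_2) (e : Z2 -> R),
      [/\ weierstrass_data mu m psi ml r r' Psi e,
          0 < mu -> e (0, 0) = 1,
          weierstrass_surface mu 1 psi Psi e xp,
          weierstrass_surface mu (-1) psi Psi e xm &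
          weierstrass_gauss psi Psi G]).
Proof.
split=> [m psi ml r r' Psi e xp xm G data xpW xmW gauss rp rm rM|xp xm G pair].
  have [x [h [s [net _ GE xpE xmE]]]] := weierstrass_net data xpW xmW gauss.
  apply: (dual_net_pair net GE xpE xmE rp rm).
  (* The last [GE] serves as the proof that h is itself a lift of G. *)
  have [mid _] := dual_net_middle net GE xpE GE.
  by rewrite -mid; apply: rM.
split=> [opp|].
  have [x [h [s [net signs GE xpE xmE]]]] := pair_dual_net pair opp.
  have [vert _ _] := net.
  have /choice [kv kvE] : forall i, exists kv : R * 'cV[R[i]]_2,
      kv.1 != 0 /\ herm (kv.1 *: h i) = spinor_mx kv.2.
    move=> i; have [hh xh _] := vert i.
    have h0 : h i != 0.
      by apply: (@mprod_neq0l _ _ (x i)); rewrite mprodC xh oner_eq0.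
    by have [k [v kv]] := null_spinor hh h0; exists (k, v).
  exact: (dual_net_weierstrass net signs kvE GE xpE xmE).
move=> [m [psi [ml [r [r' [Psi [e [data _ xpW xmW gauss]]]]]]]].
have [x [h [s [net signs GE xpE xmE]]]] := weierstrass_net data xpW xmW gauss.
exact: (dual_net_opposite_labels net GE xpE signs).
Qed.
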